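(* Let $G=([n],E)$, $n\ge 2$, be a connected graph whose block-cut tree has maximum degree bounded by $d$ ($d\ge 1$ an integer), and let $b$ be the size (number of vertices) of the largest 2-connected component of $G$. Fix $\epsilon\in(0,1)$ and let the parameter of the subroutine $\mathtt{sCentral}$ be $\kappa=\left\lceil 32d^2\log\left(\frac{2dn}{\epsilon}\right)\right\rceil$. If $\Sigma\in\mathcal M(G)$ and $\Sigma$ is generic, then, with probability at least $1-\epsilon$, the algorithm $\mathtt{ReconstructSB}([n])$ (run with the values $d,b$) has query complexity and time complexity of order $$\mathcal{O}\left(d^3 n\log(n)\left(\log\left(\frac n\epsilon\right)+b^2\right)\right)\quad\text{and}\quad \mathcal{O}\left(d^3 n\log(n)\left(\log\left(\frac n\epsilon\right)+d b^3\right)\right),$$ respectively, where the implied constants are absolute.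
   Context: Notation: $[n]=\{1,\dots,n\}$, $\Sigma=[\sigma_{ij}]$ is a symmetric positive definite $n\times n$ matrix, $K=\Sigma^{-1}$. $\mathcal M(G)$ is the set of symmetric positive definite $\Sigma$ with $K_{ij}=0$ for all $i\neq j$ with $ij\notin E(G)$. For a symmetric positive definite matrix $M$ with rows and columns indexed by $V$, its concentration graph $\mathcal G(M)$ is the graph on $V$ with an edge $ij$ ($i\neq j$) iff $(M^{-1})_{ij}\ne0$. $\Sigma_{A,B}$ is the submatrix with rows in $A$ and columns in $B$. A set $S\subseteq [n]$ separates $A,B\subseteq [n]$ (possibly intersecting) if every path from $A$ to $B$, including single-vertex paths, contains a vertex of $S$. $\Sigma\in\mathcal M(G)$ is generic if $\operatorname{rank}(\Sigma_{A,B})=\min\{|S|: S\text{ separates }A\text{ and }B\text{ in }G\}$ for all $A,B\subseteq [n]$. A graph is 2-connected if removing any vertex leaves it connected (so a single edge is 2-connected). A 2-connected component (block) of $G$ is an induced subgraph $G[V']$ with $V'$ inclusion-maximal such that $G[V']$ is 2-connected. A cut-vertex is a vertex belonging to more than one block. The block-cut tree is the bipartite graph on cut-vertices and blocks, where a cut-vertex $a$ is adjacent to a block $B$ iff $a\in B$. Entries of $\Sigma$ are accessed only through a covariance oracle, which on input $(i,j)$ returns $\sigma_{ij}$; query complexity is the number of oracle calls. Time is the number of elementary operations (oracle calls, real arithmetic and comparisons, uniform sampling of a vertex, each at unit cost). Algorithm $\mathtt{sCentral}(V)$, $V\subseteq[n]$, with integer parameter $\kappa$: for each $v\in V$ set $\hat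 s(v)=0$ and repeat $\kappa$ times: pick $u,w$ independently and uniformly at random in $V\setminus\{v\}$ (all draws independent) and, if $\sigma_{uv}\sigma_{vw}-\sigma_{uw}\sigma_{vv}\ne 0$, increase $\hat s(v)$ by $1/\kappa$. Return a vertex $v\in V$ minimizing $\hat s(v)$. Algorithm $\mathtt{ComponentsSB}(V)$: let $w=\mathtt{sCentral}(V)$, $N=\emptyset$. For all $u\in V\setminus\{w\}$: if there exists $v\in N$ with $\sigma_{uv}\sigma_{ww}-\sigma_{uw}\sigma_{vw}\neq 0$, add $u$ to $V_v$; otherwise set $V_u=\{u\}$ and add $u$ to $N$. Return the sets $V_u\cup\{w\}$, $u\in N$. Algorithm $\mathtt{ReconstructSB}(V)$: if $|V|>db$, call $\mathtt{ComponentsSB}(V)$ to get sets $V_1,\dots,V_m$ and call $\mathtt{ReconstructSB}(V_i)$ for each $i$; otherwise set $\hat E\leftarrow\hat E\cup E(\mathcal G(\Sigma_{V,V}))$, computed by inverting $\Sigma_{V,V}$. The global set $\hat E$ is initialized as $\emptyset$ and is the output. *)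

(* Defs.v *)
From mathcomp Require Import all_boot all_order all_algebra.
From mathcomp Require classical_sets.
From mathcomp Require Import reals exp.

Set Implicit Arguments.
Unset Strict Implicit.
Unset Printing Implicit Defensive.

Import Order.TTheory GRing.Theory Num.Theory.
Local Open Scope ring_scope.

(** * Graphs, blocks and the block-cut tree *)

Section Graphs.
Variables (n : nat) (e : rel 'I_n).

Definition simple_graph : Prop := symmetric e /\ irreflexive e.

Definition connected_on (S : {set 'I_n}) : bool :=
  [forall x in S, forall y in S,
     connect [rel u v | [&& u \in S, v \in S & e u v]] x y].

Definition connected_graph : bool := connected_on [set: 'I_n].

(* Connectedness is required in addition to the deletion condition, because two
   non-adjacent vertices satisfy the latter. *)
Definition two_connected (S : {set 'I_n}) : bool :=
  connected_on S && [forall v in S, connected_on (S :\ v)].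

Definition block (B : {set 'I_n}) : bool := maxset two_connected B.

Definition max_block_size : nat := \max_(B : {set 'I_n} | block B) #|B|.

Definition cut_vertex (a : 'I_n) : bool :=
  (1 < #|[set B : {set 'I_n} | block B & a \in B]|)%N.

Definition bct_node (x : 'I_n + {set 'I_n}) : bool :=
  match x with inl a => cut_vertex a | inr B => block B end.

Definition bct_adj (x y : 'I_n + {set 'I_n}) : bool :=
  [&& bct_node x, bct_node y &
     match x, y with
     | inl a, inr B | inr B, inl a => a \in B
     | _, _ => false
     end].

Definition bct_max_degree : nat :=
  \max_(x | bct_node x) #|[set y | bct_adj x y]|.

Definition separates (S A B : {set 'I_n}) : Prop :=
  forall (x : 'I_n) (p : seq 'I_n),
    path e x p -> uniq (x :: p) -> x \in A -> last x p \in B ->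
    exists2 z, z \in x :: p & z \in S.

End Graphs.

(** * Covariance matrices *)

Section Covariance.
Variables (R : realFieldType) (n : nat).

Definition posdef (M : 'M[R]_n) : Prop :=
  M^T = M /\ forall x : 'cV[R]_n, x != 0 -> 0 < (x^T *m M *m x) 0 0.

Definition in_model (e : rel 'I_n) (Sigma : 'M[R]_n) : Prop :=
  posdef Sigma /\
  forall i j : 'I_n, i != j -> ~~ e i j -> invmx Sigma i j = 0.

Definition submx_of (M : 'M[R]_n) (A B : {set 'I_n}) : 'M[R]_(#|A|, #|B|) :=
  \matrix_(i < #|A|, j < #|B|) M (enum_val i) (enum_val j).

(* rank Sigma_{A,B} is the least size of a set separating A and B *)
Definition generic (e : rel 'I_n) (Sigma : 'M[R]_n) : Prop :=
  forall A B : {set 'I_n},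
    (exists2 S, separates e S A B & #|S| = \rank (submx_of Sigma A B)) /\
    (forall S, separates e S A B -> (\rank (submx_of Sigma A B) <= #|S|)%N).

End Covariance.

(** * Randomized programs with a covariance oracle *)

(* The syntax does not mention the covariance matrix: [Query] is the only way to
   obtain its entries.
   - [Fail] is a run that returns no result;
   - [Tick] is one unit-cost real arithmetic operation or comparison;
   - [Sample V k] draws a vertex uniformly from [V], independently of all other
     draws. *)
Inductive prog (R : Type) (n : nat) (A : Type) : Type :=
| Ret of A
| Fail
| Query of 'I_n & 'I_n & (R -> prog R n A)
| Tick of prog R n A
| Sample of {set 'I_n} & ('I_n -> prog R n A).

Arguments Ret {R n A}.
Arguments Fail {R n A}.
Arguments Query {R n A}.
Arguments Tick {R n A}.
Arguments Sample {R n A}.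

Fixpoint bind (R : Type) (n : nat) (A B : Type)
    (p : prog R n A) (g : A -> prog R n B) : prog R n B :=
  match p with
  | Ret a => g a
  | Fail => Fail
  | Query i j k => Query i j (fun x => bind (k x) g)
  | Tick p' => Tick (bind p' g)
  | Sample V k => Sample V (fun v => bind (k v) g)
  end.

Notation "'let!' x := p 'in' q" := (bind p (fun x => q))
  (at level 200, x name, p at level 100, q at level 200).

Section Semantics.
Variables (R : realFieldType) (n : nat) (Sigma : 'M[R]_n) (A : Type).

(* Expectation of [f result queries time], the last two arguments being the
   final values of counters that start at [q] and [t]; runs ending in [Fail]
   contribute 0. *)
Fixpoint expect (f : A -> nat -> nat -> R) (p : prog R n A) (q t : nat) : R :=
  match p with
  | Ret a => f a q t
  | Fail => 0
  | Query i j k => expect f (k (Sigma i j)) q.+1 t.+1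
  | Tick p' => expect f p' q t.+1
  | Sample V k => (\sum_(v in V) expect f (k v) q t.+1) / #|V|%:R
  end.

(* Probability that [p] returns a result after a number of queries and an
   amount of time satisfying [P]. *)
Definition Pr (P : nat -> nat -> bool) (p : prog R n A) : R :=
  expect (fun _ q t => (P q t)%:R) p 0 0.

End Semantics.

(* For a recursive program given by its truncations [p k] to recursion depth [k]
   (deeper calls being replaced by [Fail]), the events "the run of [p k] returns a
   result with costs satisfying P" increase with [k]; the supremum of their
   probabilities is that of the event "the run of the untruncated program returns
   a result with costs satisfying P". *)
Definition Pr_rec (R : realType) (n : nat) (Sigma : 'M[R]_n) (A : Type)
    (P : nat -> nat -> bool) (p : nat -> prog R n A) : R :=
  sup (classical_sets.range (fun k => Pr Sigma P (p k))).

Section Primitives.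
Variables (R : realFieldType) (n : nat).

Definition query (ij : 'I_n * 'I_n) : prog R n R := Query ij.1 ij.2 Ret.
Definition sample (V : {set 'I_n}) : prog R n 'I_n := Sample V Ret.
Definition addM (x y : R) : prog R n R := Tick (Ret (x + y)).
Definition subM (x y : R) : prog R n R := Tick (Ret (x - y)).
Definition mulM (x y : R) : prog R n R := Tick (Ret (x * y)).
Definition divM (x y : R) : prog R n R := Tick (Ret (x / y)).
Definition ltM (x y : R) : prog R n bool := Tick (Ret (x < y)).
Definition ne0M (x : R) : prog R n bool := Tick (Ret (x != 0)).
Definition ltnM (x y : nat) : prog R n bool := Tick (Ret (x < y)%N).

Fixpoint foldM (S I : Type) (f : S -> I -> prog R n S) (s : S) (r : seq I) :
    prog R n S :=
  if r is i :: r' then let! s' := f s i in foldM f s' r' else Ret s.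

Fixpoint iterM (S : Type) (k : nat) (f : S -> prog R n S) (s : S) : prog R n S :=
  if k is k'.+1 then let! s' := f s in iterM k' f s' else Ret s.

Definition tabulateM (m p : nat) (F : 'I_m -> 'I_p -> prog R n R) :
    prog R n 'M[R]_(m, p) :=
  foldM (fun (M : 'M[R]_(m, p)) (ij : 'I_m * 'I_p) =>
           let! x := F ij.1 ij.2 in
           Ret (\matrix_(i, j) if (i, j) == ij then x else M i j))
        0 (enum {: 'I_m * 'I_p}).

End Primitives.

(** * The algorithm *)

Section Algorithm.
Variables (R : realFieldType) (n : nat).

(* sigma_a * sigma_b - sigma_c * sigma_d != 0 *)
Definition minor_ne0 (a b c d : 'I_n * 'I_n) : prog R n bool :=
  let! sa := query R a in
  let! sb := query R b in
  let! sc := query R c in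
  let! sd := query R d in
  let! x := mulM n sa sb in
  let! y := mulM n sc sd in
  let! z := subM n x y in
  ne0M n z.

Definition s_hat (kappa : nat) (V : {set 'I_n}) (v : 'I_n) : prog R n R :=
  let! inc := divM n 1 kappa%:R in
  iterM kappa (fun s : R =>
    let! u := sample R (V :\ v) in
    let! w := sample R (V :\ v) in
    let! b := minor_ne0 (u, v) (v, w) (u, w) (v, v) in
    if b then addM n s inc else Ret s) 0.

Definition argminM (r : seq ('I_n * R)) : prog R n 'I_n :=
  if r is x :: r' then
    let! y := foldM (fun y z : 'I_n * R =>
      let! b := ltM n z.2 y.2 in Ret (if b then z else y)) x r' in
    Ret y.1
  else Fail.

Definition sCentral (kappa : nat) (V : {set 'I_n}) : prog R n 'I_n :=
  let! r := foldM (fun (r : seq ('I_n * R)) v =>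
    let! s := s_hat kappa V v in Ret (rcons r (v, s))) [::] (enum V) in
  argminM r.

Fixpoint find_mate (w u : 'I_n) (N : seq 'I_n) : prog R n (option 'I_n) :=
  if N is v :: N' then
    let! b := minor_ne0 (u, v) (w, w) (u, w) (v, w) in
    if b then Ret (Some v) else find_mate w u N'
  else Ret None.

(* The state is the list of the pairs (v, V_v) for v in N. *)
Definition ComponentsSB (kappa : nat) (V : {set 'I_n}) :
    prog R n (seq {set 'I_n}) :=
  let! w := sCentral kappa V in
  let! parts := foldM (fun (parts : seq ('I_n * {set 'I_n})) u =>
    let! hit := find_mate w u [seq vW.1 | vW <- parts] in
    Ret (if hit is Some v then
           [seq (vW.1, if vW.1 == v then u |: vW.2 else vW.2) | vW <- parts]
         else rcons parts (u, [set u]))) [::] (enum (V :\ w)) in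
  Ret [seq w |: vW.2 | vW <- parts].

(* One Gauss-Jordan step on the augmented matrix: divide row k by its pivot and
   subtract multiples of it from the other rows. *)
Definition eliminateM (m : nat) (M : 'M[R]_(m, m + m)) (k : 'I_m) :
    prog R n 'M[R]_(m, m + m) :=
  let! M1 := tabulateM (fun i j =>
    if i == k then divM n (M k j) (M k (lshift m k)) else Ret (M i j)) in
  tabulateM (fun i j =>
    if i == k then Ret (M1 k j) else
    let! x := mulM n (M1 i (lshift m k)) (M1 k j) in subM n (M1 i j) x).

(* Matrix inversion by Gauss-Jordan elimination; no row exchanges are needed, as
   the pivots of a positive definite matrix are positive. *)
Definition invertM (m : nat) (M : 'M[R]_m) : prog R n 'M[R]_m :=
  let! N := foldM (@eliminateM m) (row_mx M 1%:M) (enum 'I_m) in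
  Ret (rsubmx N).

(* Edges are unordered pairs, given as two-element sets. *)
Definition conc_edges (V : {set 'I_n}) : prog R n {set {set 'I_n}} :=
  let! S := tabulateM (fun i j : 'I_#|V| => query R (enum_val i, enum_val j)) in
  let! K := invertM S in
  foldM (fun (E : {set {set 'I_n}}) (ij : 'I_#|V| * 'I_#|V|) =>
    let! b := ne0M n (K ij.1 ij.2) in
    Ret (if b then [set enum_val ij.1; enum_val ij.2] |: E else E))
    set0 [seq ij <- enum {: 'I_#|V| * 'I_#|V|} | ij.1 != ij.2].

(* Recursion depth limited by [depth]; [E] is the current value of the global
   edge set. *)
Fixpoint ReconstructSB_rec (kappa d b depth : nat) (E : {set {set 'I_n}})
    (V : {set 'I_n}) : prog R n {set {set 'I_n}} :=
  if depth is depth'.+1 then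
    let! large := ltnM R n (d * b) #|V| in
    if large then
      let! Vs := ComponentsSB kappa V in
      foldM (ReconstructSB_rec kappa d b depth') E Vs
    else
      let! E' := conc_edges V in Ret (E :|: E')
  else Fail.

(* ReconstructSB([n]), through its truncations to finite recursion depth *)
Definition ReconstructSB (kappa d b depth : nat) : prog R n {set {set 'I_n}} :=
  ReconstructSB_rec kappa d b depth set0 [set: 'I_n].

End Algorithm.

Definition kappa_of (R : realType) (d n : nat) (eps : R) : nat :=
  `|Num.ceil (32 * d%:R ^+ 2 * ln (2 * d%:R * n%:R / eps))|%N.

(* Main.v *)
Require Import Defs.
From mathcomp Require Import all_boot all_order all_algebra.
From mathcomp Require Import boolp reals sequences exp.
From mathcomp Require Import zify ring lra.

Set Implicit Arguments.
Unset Strict Implicit.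
Unset Printing Implicit Defensive.

Import Order.TTheory GRing.Theory Num.Theory.
Local Open Scope ring_scope.

(** Call [u] and [v] joined at [w] if some path from [u] to [v] avoids [w]; by
    genericity the 2x2 minors computed by the algorithm decide this relation, and
    the parts of [V] at [w] are the classes of the relation on [V - w].  Each
    class contains a neighbour of [w], hence determines its own block through
    [w], so there are at most [d] classes.

    If [d b < |V|], a vertex [v] of [V] whose largest class is as small as
    possible has a fraction at most [1 - 3/(4d)] of joined pairs: otherwise the
    parts behind the at most [d] cut-vertices of the block next to [v] inside that
    class are too small to fill the class.  With [delta = 1/(4d)], Hoeffding's inequality bounds
    the probability of an estimate being off by [delta] by [2 (eps/(2dn))^2], and
    if no estimate is, the chosen vertex has a fraction at most [1 - 1/(4d)] of
    joined pairs, so all its parts satisfy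
    [|V_i| - 1 <= (1 - 1/(8d)) (|V| - 1)].  Since [|V| - 1] is additive over the
    parts, the recursion has depth [O(d log n)], every level costs
    [O(n (kappa + d))] in addition to the base cases, and there are fewer than
    [n] calls of [sCentral], which gives the union bound. *)

(** * Separation, blocks and the block-cut tree *)

Section RelIn.
Variables (T : finType) (r : rel T).

Definition rel_in (S : {set T}) (u v : T) : bool :=
  [&& u \in S, v \in S & r u v].

Arguments rel_in S u v /.

Lemma connect_rel_in_sym (S : {set T}) :
  symmetric r -> connect_sym (rel_in S).
Proof.
move=> rs; apply: sym_connect_sym => x y /=.
by rewrite rs andbCA.
Qed.

Lemma connect_rel_inW (S S' : {set T}) x y :
  (forall u, connect (rel_in S) x u -> u \in S') ->
  connect (rel_in S) x y -> connect (rel_in S') x y.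
Proof.
move=> H /connectP[p]; elim: p x H => [|z p IH] x H /=; first by move=> _ ->.
move=> /andP[xz pz] yE.
have Sz : connect (rel_in S) x z by apply: connect1.
have {}IH := IH z (fun u zu => H u (connect_trans Sz zu)) pz yE.
apply: connect_trans IH; apply: connect1 => /=.
by rewrite !H ?connect0 //; case/and3P: xz.
Qed.

Lemma connect_rel_inS (S S' : {set T}) x y :
  S \subset S' -> connect (rel_in S) x y -> connect (rel_in S') x y.
Proof.
move=> sub; apply: connect_sub => u v /and3P[uS vS ruv].
by apply: connect1; rewrite /= !(subsetP sub) //.
Qed.

Lemma connect_rel_in_mem (S : {set T}) x y :
  connect (rel_in S) x y -> x \in S -> y \in S.
Proof.
move=> /connectP[p]; elim: p x => [|z p IH] x /=; first by move=> _ ->.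
by move=> /andP[/and3P[_ zS _] pz] yl _; apply: IH yl zS.
Qed.

Lemma path_connect_rel_in (S : {set T}) x p y :
  path r x p -> {subset x :: p <= S} -> y \in x :: p -> connect (rel_in S) x y.
Proof.
elim: p x y => [|z p IH] x y /=.
  by move=> _ _; rewrite inE => /eqP->.
move=> /andP[xz pz] sub; rewrite inE => /predU1P[-> //|yp].
have zS : z \in S by apply: sub; rewrite !inE eqxx orbT.
apply: (@connect_trans _ _ z); last first.
  by apply: IH => // u up; apply: sub; rewrite inE up orbT.
by apply: connect1 => /=; rewrite xz zS sub ?inE ?eqxx.
Qed.

(** The path is cut at its first entry into [B]: [z] is the entry point and [k] the vertex just
    before it. *)
Lemma connect_exit (B : {set T}) x y :
  connect r x y -> x \notin B -> y \in B ->
  exists k z, [/\ connect (rel_in (~: B)) x k, k \notin B, r k z & z \in B].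
Proof.
move=> /connectP[p]; elim: p x => [|z p IH] x /=.
  by move=> _ -> /negPf->.
move=> /andP[xz pz] yl xB yB.
have [zB|zB] := boolP (z \in B); first by exists x, z.
have [k [z' [ck kB kz' z'B]]] := IH z pz yl zB yB.
exists k, z'; split => //; apply: (connect_trans _ ck); apply: connect1 => /=.
by rewrite !inE xB zB.
Qed.

End RelIn.

Arguments rel_in {T} r S u v /.

(** * Separation by one vertex, and ears attached to blocks *)

Section Separation.
Variables (n : nat) (e : rel 'I_n).
Hypothesis e_simple : simple_graph e.

Let e_sym : symmetric e. Proof. by case: e_simple. Qed.
Let e_irr : irreflexive e. Proof. by case: e_simple. Qed.

(** [connect] is reflexive and [rel_in] gives [w] no neighbours, so this is an equivalence on all
    vertices in which [w] forms a class of its own. *)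
Definition joined (w : 'I_n) : rel 'I_n := connect (rel_in e (~: [set w])).

Lemma joined_refl w : reflexive (joined w).
Proof. by move=> x; apply: connect0. Qed.

Lemma joined_sym w : symmetric (joined w).
Proof. exact: connect_rel_in_sym. Qed.

Lemma joined_trans w : transitive (joined w).
Proof. exact: connect_trans. Qed.

Lemma joined_neq w x y : joined w x y -> x != w -> y != w.
Proof.
by move=> /connect_rel_in_mem H xw; have := H; rewrite !inE; apply.
Qed.

(* A path avoiding [w] stays in a single class, so it also avoids every vertex
   of the other classes. *)
Lemma joined_other w z x y :
  ~~ joined w x z -> joined w x y -> joined z x y.
Proof.
move=> nxz; apply: connect_rel_inW => u xu; rewrite !inE.
by apply: contraNneq nxz => <-.
Qed.

Lemma joined_edge w x y : x != w -> y != w -> e x y -> joined w x y.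
Proof. by move=> xw yw xy; apply: connect1; rewrite /= !inE xw yw. Qed.

Lemma connected_onP (S : {set 'I_n}) :
  reflect {in S &, forall x y, connect (rel_in e S) x y} (connected_on e S).
Proof.
apply: (iffP forall_inP) => [H x y xS yS|H x xS].
  exact: (forall_inP (H x xS)).
by apply/forall_inP => y yS; apply: H.
Qed.

Lemma connected_on_hub (S : {set 'I_n}) h :
  (forall x, x \in S -> connect (rel_in e S) x h) -> connected_on e S.
Proof.
move=> H; apply/connected_onP => x y xS yS.
apply: connect_trans (H x xS) _.
by rewrite connect_rel_in_sym //; apply: H.
Qed.

Lemma two_connected_joined (B : {set 'I_n}) w x y :
  two_connected e B -> w \in B -> x \in B -> y \in B -> x != w -> y != w ->
  joined w x y.
Proof.
move=> /andP[_ /forall_inP H] wB xB yB xw yw.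
have /connected_onP/(_ x y) := H w wB.
rewrite !inE xw yw xB yB => /(_ isT isT); apply: connect_rel_inS.
by apply/subsetP => u; rewrite !inE => /andP[].
Qed.

Lemma two_connected_edge x y : e x y -> two_connected e [set x; y].
Proof.
move=> xy; apply/andP; split.
  apply: (@connected_on_hub _ x) => u; rewrite !inE => /orP[]/eqP->.
    exact: connect0.
  by apply: connect1; rewrite /= !inE !eqxx orbT e_sym.
apply/forall_inP => v; rewrite !inE => vxy.
pose h := if v == x then y else x.
apply: (@connected_on_hub _ h) => u; rewrite !inE /h.
move=> /andP[]; case: (v =P x) vxy => [->|] _.
  by move=> /negPf-> /eqP->; apply: connect0.
by move=> /eqP-> uy /orP[/eqP->|]; rewrite ?(negPf uy) //; apply: connect0.
Qed.

Lemma block_edge x y : e x y -> exists2 B, block e B & (x \in B) && (y \in B).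
Proof.
move=> /two_connected_edge /maxset_exists[B mB sub].
by exists B => //; rewrite !(subsetP sub) // !inE eqxx ?orbT.
Qed.

Lemma connect_cat_right (S : {set 'I_n}) h s y :
  path e h s -> {subset h :: s <= S} -> y \in h :: s ->
  connect (rel_in e S) y (last h s).
Proof.
move=> ps sub yS; apply: (@connect_trans _ _ h).
  by rewrite connect_rel_in_sym //; apply: path_connect_rel_in ps sub yS.
by apply: path_connect_rel_in ps sub _; apply: mem_last.
Qed.

(** After deletion of a vertex of [B] the whole ear still hangs on a surviving endpoint; after
    deletion of a vertex of the ear, the piece before it hangs on [z1] and the piece after it on
    [z2]. *)
Lemma two_connected_ear (B : {set 'I_n}) z1 z2 q :
  two_connected e B -> z1 \in B -> z2 \in B -> z1 != z2 ->
  path e z1 (rcons q z2) -> uniq q -> {subset q <= ~: B} ->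
  two_connected e (B :|: [set x in q]).
Proof.
move=> /andP[/connected_onP cB /forall_inP dB] z1B z2B z12 pq uq qB.
have from_z1 (S : {set 'I_n}) s t : q = s ++ t -> z1 \in S ->
    {subset s <= S} -> {in s, forall x, connect (rel_in e S) x z1}.
  move=> qE z1S sS x xs; rewrite connect_rel_in_sym //.
  move: pq; rewrite qE rcons_cat cat_path => /andP[ps _].
  apply: path_connect_rel_in ps _ _; last by rewrite inE xs orbT.
  by move=> u; rewrite inE => /predU1P[->|/sS].
have from_z2 (S : {set 'I_n}) s t : q = s ++ t -> z2 \in S ->
    {subset t <= S} -> {in t, forall x, connect (rel_in e S) x z2}.
  case: t => [//|a t] qE z2S tS x xt.
  move: pq; rewrite qE rcons_cat cat_path /= => /and3P[_ _ pt].
  rewrite -(last_rcons a t z2).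
  apply: connect_cat_right pt _ _; last by rewrite -rcons_cons mem_rcons inE xt orbT.
  by move=> u; rewrite -rcons_cons mem_rcons inE => /predU1P[->|/tS].
apply/andP; split.
  apply: (@connected_on_hub _ z1) => x; rewrite !inE => /orP[xB|xq].
    by apply: connect_rel_inS (cB _ _ xB z1B); apply: subsetUl.
  apply: from_z1 (esym (cats0 q)) _ _ _ xq; first by rewrite inE z1B.
  by move=> u uq'; rewrite !inE uq' orbT.
apply/forall_inP => u; rewrite inE => /orP[uB|].
  have subB : B :\ u \subset (B :|: [set x in q]) :\ u.
    by apply: setSD; apply: subsetUl.
  have qS : {subset q <= (B :|: [set x in q]) :\ u}.
    move=> x xq; rewrite !inE xq orbT andbT.
    by apply: contraTneq uB => <-; have := qB x xq; rewrite inE.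
  have [h /andP[hB hu] hq] : exists2 h, (h \in B) && (h != u) &
      {in q, forall x, connect (rel_in e ((B :|: [set x in q]) :\ u)) x h}.
    have [z1u|z1u] := eqVneq z1 u.
      have z2u : z2 != u by rewrite -z1u eq_sym.
      exists z2; first by rewrite z2B.
      apply: (@from_z2 _ [::] q) => //.
      by rewrite !inE z2B z2u.
    exists z1; first by rewrite z1B.
    apply: (@from_z1 _ q [::]) => //; first by rewrite cats0.
    by rewrite !inE z1B z1u.
  apply: (@connected_on_hub _ h) => x; rewrite !inE => /andP[xu /orP[xB|/hq//]].
  have /connected_onP cBu := dB u uB.
  by apply: connect_rel_inS subB (cBu _ _ _ _); rewrite !inE ?xu ?hu.
rewrite inE => uq'.
have uB : u \notin B by have := qB u uq'; rewrite inE.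
case/splitPr: uq' qB uq pq from_z1 from_z2 => q1 q2 qB uq pq from_z1 from_z2.
set S := _ :\ u.
have BS : B \subset S.
  by apply/subsetP => x xB; rewrite !inE xB andbT; apply: contraTneq xB => ->.
have := uq; rewrite cat_uniq /= => /and4P[uq1 hq uq2 _].
have uq1n : u \notin q1 by case/norP: hq.
have q1S : {subset q1 <= S}.
  move=> x xq; rewrite !inE mem_cat xq orbT andbT.
  by apply: contraTneq xq => ->.
have q2S : {subset q2 <= S}.
  move=> x xq; rewrite !inE mem_cat !inE xq !orbT andbT.
  by apply: contraTneq xq => ->.
apply: (@connected_on_hub _ z1) => x.
have cBS y : y \in B -> connect (rel_in e S) y z1.
  by move=> yB; apply: connect_rel_inS BS (cB _ _ yB z1B).
rewrite !inE mem_cat inE => /andP[xu /or4P[/cBS//|||]].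
- by apply: (@from_z1 S q1 (u :: q2)) => //; apply: (subsetP BS).
- by rewrite (negPf xu).
- move=> xq2; apply: (connect_trans _ (cBS _ z2B)).
  apply: (@from_z2 S (rcons q1 u) q2) => //; first by rewrite cat_rcons.
  by apply: (subsetP BS).
Qed.

(** Two entry points into [B] from [x] would be the ends of an ear, and adding the ear would
    contradict the maximality of the block. *)
Lemma block_gate (B : {set 'I_n}) x :
  connected_graph e -> block e B -> B != set0 -> x \notin B ->
  exists2 z, z \in B & forall y, y \in B -> y != z -> ~~ joined z x y.
Proof.
move=> /connected_onP cG blB /set0Pn[b0 b0B] xB.
have [B2 Bmax] := maxsetP blB.
have cx y : connect e x y.
  by apply: connect_sub (cG x y _ _); rewrite ?inE // => u v /and3P[_ _ /connect1].
have [k [z [ck kB kz zB]]] := connect_exit (cx b0) xB b0B.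
exists z => // y yB yz; apply/negP => /connect_exit/(_ xB yB).
move=> [k' [z' [ck' k'B /and3P[_ z'z k'z'] z'B]]].
move: z'z; rewrite !inE => z'z.
have {}ck' : connect (rel_in e (~: B)) x k'.
  by apply: connect_sub ck' => u v /and3P[uB vB /and3P[_ _ uv]];
     apply: connect1; rewrite /= uB vB.
have : connect (rel_in e (~: B)) k k'.
  by apply: (connect_trans _ ck'); rewrite connect_rel_in_sym.
(* A duplicate-free path off [B] between the vertices just before the two entry points is the
   interior of the ear. *)
move=> /connectP[p0 /shortenP[p pp up _] k'E].
have ep : path e z (rcons (k :: p) z').
  rewrite /= e_sym kz /= rcons_path -k'E k'z' andbT.
  by apply: sub_path pp => u v /and3P[].
have subp : {subset k :: p <= ~: B}.
  move=> u up'; apply: connect_rel_in_mem (_ : k \in ~: B); last by rewrite inE.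
  by apply: path_connect pp _ up'.
have zz' : z != z' by rewrite eq_sym.
have := Bmax _ (two_connected_ear B2 zB z'B zz' ep up subp) (subsetUl _ _).
by move=> /setP/(_ k); rewrite !inE eqxx orbT (negPf kB).
Qed.

Lemma neighbour_joined w u :
  connected_graph e -> u != w -> exists2 y, e w y & joined w u y.
Proof.
move=> /connected_onP cG uw.
have cu : connect e u w.
  by apply: connect_sub (cG u w _ _); rewrite ?inE // => a b /and3P[_ _ /connect1].
have [||k [z [ck _ kz]]] := connect_exit (B := [set w]) cu; rewrite ?inE //.
by move=> /eqP zw; exists k => //; rewrite e_sym -zw.
Qed.

Section BoundedDegree.
Variable d : nat.
Hypothesis e_conn : connected_graph e.
Hypothesis deg_le : (bct_max_degree e <= d)%N.

Lemma bct_degree_le x : bct_node e x -> (#|[set y | bct_adj e x y]| <= d)%N.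
Proof.
move=> xn; apply: leq_trans deg_le.
exact: (@leq_bigmax_cond _ (bct_node e) (fun x => #|[set y | bct_adj e x y]|)).
Qed.

(** Each [u] in [A] is sent to a block through [w] that meets the class of [u]; a block minus [w]
    lies in one class, so the map is injective. *)
Lemma separated_card_blocks w (A : {set 'I_n}) :
  w \notin A -> {in A &, forall u v, joined w u v -> u = v} ->
  (#|A| <= #|[set B | block e B & w \in B]|)%N.
Proof.
move=> wA inj.
have ex u : u \in A -> exists B : {set 'I_n}, block e B && (w \in B) &&
    [exists y in B, (y != w) && joined w u y].
  move=> uA; have uw : u != w by apply: contraNneq wA => <-.
  have [y wy uy] := neighbour_joined e_conn uw.
  have [B blB /andP[wB yB]] := block_edge wy.
  exists B; rewrite blB wB; apply/exists_inP; exists y => //.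
  by rewrite uy andbT; apply: contraTneq wy => ->; rewrite e_irr.
pose f u := odflt set0 [pick B : {set 'I_n} | block e B && (w \in B) &&
    [exists y in B, (y != w) && joined w u y]].
have fP u : u \in A -> block e (f u) && (w \in f u) &&
    [exists y in f u, (y != w) && joined w u y].
  move=> /ex[B HB]; rewrite /f; case: pickP => [//|] /(_ B).
  by rewrite HB.
rewrite -(card_in_imset (f := f) (D := A)).
  apply: subset_leq_card; apply/subsetP => _ /imsetP[u /fP/andP[+ _] ->].
  by rewrite inE.
move=> u v uA vA fuv; apply: inj => //.
have /andP[/andP[blB wB] /exists_inP[y yB /andP[yw uy]]] := fP _ uA.
have /andP[_ /exists_inP[y' y'B /andP[y'w vy']]] := fP _ vA.
rewrite -fuv in y'B.
have [B2 _] := maxsetP blB.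
apply: joined_trans uy _; rewrite joined_sym.
by apply: joined_trans vy' _; apply: two_connected_joined B2 wB y'B yB y'w yw.
Qed.

Lemma separated_cut_vertex w x y :
  x != w -> y != w -> ~~ joined w x y -> cut_vertex e w.
Proof.
move=> xw yw nxy.
have xy : x != y by apply: contraNneq nxy => ->; apply: joined_refl.
have := @separated_card_blocks w [set x; y].
rewrite /cut_vertex cards2 xy; apply.
  by rewrite !inE ![w == _]eq_sym negb_or xw.
move=> u v; rewrite !inE => /orP[]/eqP-> /orP[]/eqP-> //; rewrite ?(negPf nxy) //.
by rewrite joined_sym (negPf nxy).
Qed.

Lemma cut_vertex_blocks_le w :
  cut_vertex e w -> (#|[set B | block e B & w \in B]| <= d)%N.
Proof.
move=> cw; apply: leq_trans (@bct_degree_le (inl w) cw).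
have inr_i : injective (@inr 'I_n {set 'I_n}) by move=> ? ? [].
rewrite -(card_imset _ inr_i).
apply: subset_leq_card; apply/subsetP => _ /imsetP[B + ->].
by rewrite inE => /andP[blB wB]; rewrite inE /bct_adj /= cw blB wB.
Qed.

Lemma separated_degree_ge2 w x y :
  x != w -> y != w -> ~~ joined w x y -> (1 < d)%N.
Proof.
move=> xw yw /(separated_cut_vertex xw yw) cw.
exact: leq_trans (cut_vertex_blocks_le cw).
Qed.

(** The degree bound speaks of nodes of the tree only: with two or more classes [w] is a cut-vertex,
    and otherwise [0 < d] suffices. *)
Lemma separated_card_le w (A : {set 'I_n}) :
  (0 < d)%N -> w \notin A -> {in A &, forall u v, joined w u v -> u = v} ->
  (#|A| <= d)%N.
Proof.
move=> d0 wA inj; have [A1|A1] := leqP #|A| 1; first exact: leq_trans A1 d0.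
have le := separated_card_blocks wA inj.
apply: (leq_trans le); apply: cut_vertex_blocks_le.
exact: leq_trans A1 le.
Qed.

Lemma block_cut_vertices_le (B Z : {set 'I_n}) :
  block e B -> Z \subset B -> {in Z, forall z, cut_vertex e z} ->
  (#|Z| <= d)%N.
Proof.
move=> blB ZB Zc; apply: leq_trans (@bct_degree_le (inr B) blB).
have inl_i : injective (@inl 'I_n {set 'I_n}) by move=> ? ? [].
rewrite -(card_imset _ inl_i).
apply: subset_leq_card; apply/subsetP => _ /imsetP[z zZ ->].
by rewrite inE /bct_adj /= blB Zc // (subsetP ZB).
Qed.

(** [joined] refers to paths of the whole graph; this closure, kept along the recursion, puts the
    gates met in the counting argument back into [V]. *)
Definition sep_closed (V : {set 'I_n}) : Prop :=
  forall x y z, x \in V -> y \in V -> z != x -> z != y ->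
    ~~ joined z x y -> z \in V.

Definition branch (V : {set 'I_n}) w v : {set 'I_n} :=
  [set x in V :\ w | joined w x v].

(** Ordered pairs with repetition, matching independent draws: this is the sum of the squares of the
    class sizes at [w]. *)
Definition joined_pairs (V : {set 'I_n}) w : nat :=
  \sum_(u in V :\ w) #|branch V w u|.

(** A vertex [z] other than [w] and outside the class of [v] separates nothing here: every vertex of
    the class reaches [w] off [z], through a neighbour of [w] in the class. *)
Lemma sep_closed_branch V w v :
  sep_closed V -> w \in V -> v \in V -> v != w -> sep_closed (w |: branch V w v).
Proof.
move=> cV wV vV vw x y z xV' yV' zx zy nxy.
have sub u : u \in w |: branch V w v -> u \in V.
  by rewrite !inE => /orP[/eqP->|/andP[/andP[]]].
have zV : z \in V by apply: cV zx zy nxy; apply: sub.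
rewrite !inE zV andbT; have [//|zw /=] := eqVneq z w.
apply/negPn/negP => nzv.
have Lw u : joined w u v -> joined z u w.
  move=> uv; have uw : u != w.
    apply: contraTneq uv => ->; rewrite joined_sym.
    by apply/negP => /joined_neq/(_ vw); rewrite eqxx.
  have [t wt ut] := neighbour_joined e_conn uw.
  have uz : z != u by apply: contraNneq nzv => ->.
  have ntz : ~~ joined w u z.
    by apply: contra nzv => uz'; apply: joined_trans uv; rewrite joined_sym.
  have tz : t != z by apply: contraNneq ntz => <-.
  apply: joined_trans (joined_other ntz ut) _.
  by apply: joined_edge; rewrite // 1?eq_sym // e_sym.
move: xV' yV' nxy; rewrite !inE.
have Lz u : (u == w) || ((u != w) && (u \in V) && joined w u v) -> joined z u w.
  by move=> /orP[/eqP->|/andP[_]]; [exact: joined_refl | exact: Lw].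
move=> /Lz xw /Lz yw /negP; apply.
by apply: joined_trans xw _; rewrite joined_sym.
Qed.

Lemma branch_eq V w u v : joined w u v -> branch V w u = branch V w v.
Proof.
move=> uv; apply/setP => x; rewrite !inE; congr (_ && _); apply/idP/idP => H.
  exact: joined_trans uv.
by apply: joined_trans H _; rewrite joined_sym.
Qed.

Lemma sqr_branch_le V w v :
  (#|branch V w v| ^ 2 <= joined_pairs V w)%N.
Proof.
rewrite /joined_pairs (big_setID (branch V w v)) /=.
apply: leq_trans (leq_addr _ _).
have /setIidPr-> : branch V w v \subset V :\ w.
  by apply/subsetP => u; rewrite inE => /andP[].
rewrite (eq_bigr (fun=> #|branch V w v|)) ?sum_nat_const ?mulnn //.
by move=> u; rewrite inE => /andP[_ /branch_eq->].
Qed.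

(** Pairs starting in the largest class number at most [m ^ 2]; each of the [r] other vertices has
    its class among those [r], and of size at most [m]. *)
Lemma joined_pairs_le V w v :
  let m := #|branch V w v| in let r := (#|V :\ w| - m)%N in
  {in V :\ w, forall u, #|branch V w u| <= m}%N ->
  (joined_pairs V w <= m ^ 2 + r * minn m r)%N.
Proof.
move=> m r H; rewrite /joined_pairs (big_setID (branch V w v)) /=.
have sub u : branch V w u \subset V :\ w.
  by apply/subsetP => x; rewrite inE => /andP[].
have mI : #|(V :\ w) :&: branch V w v| = m by rewrite (setIidPr (sub v)).
have rD : #|(V :\ w) :\: branch V w v| = r by rewrite cardsD mI.
apply: leq_add.
  rewrite -mulnn -{1}mI -sum_nat_const; apply: leq_sum => u.
  by rewrite inE => /andP[/H].
rewrite -rD -sum_nat_const rD; apply: leq_sum => u.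
rewrite inE => /andP[nuv uV]; rewrite leq_min H //= -rD.
apply: subset_leq_card; apply/subsetP => x xu; rewrite inE (subsetP (sub u)) //.
rewrite andbT; apply: contra nuv; rewrite !inE => /andP[_ xv].
move: xu uV; rewrite !inE => /andP[_ xu] -> /=.
by apply: joined_trans xv; rewrite joined_sym.
Qed.

(** If [r <= m], then [m ^ 2 + r ^ 2] misses [2 * m * r] of all pairs, so [8 * c * r * m] must be at
    least [3 * (m + r) ^ 2]. For [m >= 3 * r] this follows from the hypothesis on [m + r], and for
    smaller [m] from [c >= 2]. *)
Lemma unbalanced_pairs_bound c m r :
  (1 < c)%N -> (m + r <= 2 * c * r)%N ->
  (4 * c * (m ^ 2 + r * minn m r) <= (4 * c - 3) * (m + r) ^ 2)%N.
Proof.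
move=> c1 le; have [rm|mr] := leqP r m; last first.
  have cE : (4 * c - 3 = 4 * (c - 2) + 5)%N by lia.
  have c2 : (c = (c - 2) + 2)%N by lia.
  by move: (c - 2)%N c2 cE => k -> ->; rewrite -!mulnn; nia.
have [a mE] : exists a, m = (r + a)%N by exists (m - r)%N; lia.
have [s sE] : exists s, (2 * c * r = m + r + s)%N.
  by exists (2 * c * r - (m + r))%N; lia.
have key : (3 * (m + r) ^ 2 <= 8 * c * r * m)%N.
  have -> : (8 * c * r * m = 4 * (m + r + s) * m)%N by rewrite -sE; ring.
  have sa : (2 * r <= a + s)%N by nia.
  rewrite {}mE in sE *; rewrite -!mulnn.
  have [ra|ar] := leqP (2 * r) a; first by nia.
  by have [t rE] : exists t, (2 * r = a + t)%N; [exists (2 * r - a)%N; lia | nia].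
have -> : (m ^ 2 + r * r = (m + r) ^ 2 - 2 * (m * r))%N by rewrite -!mulnn; nia.
by rewrite mulnBr mulnBl; nia.
Qed.

(* [v] minimizes the size [m] of its largest class [C], and [B] is a block through
   [v] meeting [C].  Let [r] be the number of vertices of [V - v] outside [C].  By
   minimality of [v], at most [r] vertices of [V] lie behind any other vertex of
   [B], so that [m < b + (d - 1) r]: the classes at [v] are unbalanced by at most
   a factor of order [d]. *)
Lemma central_vertex (V : {set 'I_n}) :
  sep_closed V -> (1 < #|V|)%N -> (d * max_block_size e < #|V|)%N -> (0 < d)%N ->
  (1 < d)%N /\ exists2 v, v \in V &
    (4 * d * joined_pairs V v <= (4 * d - 3) * #|V :\ v| ^ 2)%N.
Proof.
move=> cV V1 Vdb d0.
have [v0 v0V] : exists v, v \in V by apply/card_gt0P; apply: ltnW.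
pose mx z := \max_(x in V :\ z) #|branch V z x|.
case: (arg_minnP mx v0V) => v vV vmin.
have cardV z : z \in V -> #|V :\ z| = #|V|.-1 by move=> zV; rewrite [in RHS](cardsD1 z) zV.
have V0 : (0 < #|V|.-1)%N by rewrite -ltnS prednK // ltnW.
have [x0 x0V mxE] : {x0 | x0 \in V :\ v & mx v = #|branch V v x0|}.
  by apply: eq_bigmax_cond; rewrite cardV.
set C := branch V v x0 in mxE; set m := #|C|; set r := (#|V :\ v| - m)%N.
have CV : C \subset V :\ v by apply/subsetP => x; rewrite inE => /andP[].
have mr : (m + r = #|V :\ v|)%N by rewrite subnKC // subset_leq_card.
have Cmax : {in V :\ v, forall u, #|branch V v u| <= m}%N.
  move=> u uV; rewrite -[m]mxE.
  exact: (@leq_bigmax_cond _ (mem (V :\ v)) (fun x => #|branch V v x|)).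
have x0v : x0 != v by move: x0V; rewrite !inE => /andP[].
have [y vy x0y] := neighbour_joined e_conn x0v.
have [B blB /andP[vB yB]] := block_edge vy.
have yv : y != v by apply: contraTneq vy => ->; rewrite e_irr.
have [B2 _] := maxsetP blB.
(* [D z] is what [z] cuts off from [v]; [Z] collects the vertices of [B] that cut something off. *)
pose D z := [set x in V :\ z | ~~ joined z x v].
pose Z := [set z in B :\ v | (z \in V) && (D z != set0)].
have joinvC x : x \in C -> joined v x y.
  by rewrite inE => /andP[_ xx0]; apply: joined_trans xx0 x0y.
have joinBv z : z \in B -> z != v -> joined v z y.
  by move=> zB zv; apply: two_connected_joined B2 vB zB yB zv yv.
have DC z x : z \in Z -> x \in D z -> x \in C :\ z.
  rewrite !inE => /andP[/andP[zv zB] /andP[zV _]] /andP[/andP[xz xV] nxv].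
  have xv : x != v by apply: contraNneq nxv => ->; apply: joined_refl.
  (* Otherwise a path from [x] to a neighbour of [v] would avoid [z] and lead on to [v]. *)
  rewrite xz xv xV /=; have xz' : joined v x z.
    apply: contraNT nxv => nxz; have [t vt xt] := neighbour_joined e_conn xv.
    apply: joined_trans (joined_other nxz xt) _; apply: joined_edge.
    - by apply: contraNneq nxz => <-.
    - by rewrite eq_sym.
    - by rewrite e_sym.
  apply: joined_trans xz' _; apply: joined_trans (joinBv _ zB zv) _.
  by rewrite joined_sym.
(* [D z] is a union of classes at [z] and has fewer than [m] vertices. By minimality of [v] the
   largest class at [z] has at least [m], so it is disjoint from [D z], whence
   [m + #|D z| <= #|V| - 1]. *)
have Dle z : z \in Z -> (#|D z| <= r)%N.
  move=> zZ; move: (zZ); rewrite !inE => /andP[/andP[zv zB] /andP[zV _]].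
  have zC : z \in C.
    rewrite !inE zv zV; apply: joined_trans (joinBv _ zB zv) _.
    by rewrite joined_sym.
  have Dm : (#|D z| < m)%N.
    rewrite /m (cardsD1 z C) zC ltnS; apply: subset_leq_card.
    by apply/subsetP => x; apply: DC.
  have [|x xV xE] := @eq_bigmax_cond _ (mem (V :\ z)) (fun x => #|branch V z x|).
    by rewrite -[#|_|]/#|V :\ z| cardV.
  have := vmin z zV; rewrite mxE /mx xE => mle.
  have xnD : x \notin D z.
    apply: contraL mle => xD; rewrite -ltnNge; apply: leq_ltn_trans Dm.
    apply: subset_leq_card; apply/subsetP => u; rewrite !inE => /andP[-> ux] /=.
    move: xD; rewrite inE => /andP[_]; apply: contra; apply: joined_trans.
    by rewrite joined_sym.
  have : branch V z x \subset (V :\ z) :\: D z.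
    apply/subsetP => u; rewrite !inE => /andP[/andP[-> ->] ux] /=; rewrite andbT negbK.
    move: xnD; rewrite inE xV /= negbK; exact: joined_trans.
  move=> /subset_leq_card; rewrite cardsD.
  have /setIidPr-> : D z \subset V :\ z by apply/subsetP => u; rewrite inE => /andP[].
  rewrite /r !cardV //.
  have arith (p k q a : nat) : (q < a -> a <= k -> k <= p - q -> q <= p - a)%N.
    by clear; lia.
  exact: arith Dm mle.
(* A vertex of [C] off [B] has a gate [z] in [B]; the gate is not [v], because at [v] that vertex is
   joined to [y]. *)
have cover : C \subset (B :\ v) :|: \bigcup_(z in Z) D z.
  apply/subsetP => x xC; rewrite inE.
  have /andP[xv xV] : (x != v) && (x \in V).
    by have := subsetP CV x xC; rewrite !inE.
  have [xB|xB] := boolP (x \in B); first by rewrite !inE xv xB.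
  have [|z zB zsep] := block_gate e_conn blB _ xB.
    by apply/set0Pn; exists v.
  have zv : z != v.
    apply/eqP => zv; have := zsep y yB; rewrite zv yv joinvC // => /(_ isT).
    by [].
  have nxv : ~~ joined z x v by apply: zsep => //; rewrite eq_sym.
  have zx : z != x by apply: contraNneq xB => <-.
  have zV : z \in V by apply: cV nxv => //.
  have xD : x \in D z by rewrite !inE eq_sym zx xV nxv.
  apply/orP; right; apply/bigcupP; exists z => //.
  by rewrite !inE zv zB zV; apply/set0Pn; exists x.
have Bb : (#|B| <= max_block_size e)%N.
  exact: (@leq_bigmax_cond _ (block e) (fun B : {set 'I_n} => #|B|)).
have mle : (m <= #|B| - 1 + #|Z| * r)%N.
  apply: (leq_trans (subset_leq_card cover)).
  apply: (leq_trans (leq_of_leqif (leq_card_setU _ _))).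
  apply: leq_add; first by rewrite (cardsD1 v B) vB addKn.
  rewrite -sum_nat_const; apply: (leq_trans _ (leq_sum _ Dle)).
  apply: (big_ind2 (fun (A : {set 'I_n}) k => #|A| <= k)%N); rewrite ?cards0 //.
  move=> A k A' k' Ak Ak'; apply: (leq_trans (leq_of_leqif (leq_card_setU _ _))).
  exact: leq_add.
(* With [r = 0] the whole of [V] would be no larger than [B], against the size assumption. A vertex
   outside [C] then makes [v] a cut-vertex, so [1 < d]. *)
have r0 : (0 < r)%N.
  rewrite lt0n; apply: contraTneq mle => r0; rewrite r0 muln0 addn0 -ltnNge.
  have arith (k p q s t : nat) :
      (k = p.-1 -> 1 < p -> q <= s -> s <= t -> t < p -> q - 1 < k)%N.
    by clear; lia.
  apply: arith V1 Bb (leq_pmull _ d0) Vdb; by rewrite -(cardV v vV) -mr r0 addn0.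
have [x /setDP[xV xC]] : exists x, x \in (V :\ v) :\: C.
  by apply/card_gt0P; rewrite cardsD (setIidPr CV).
have xv : x != v by move: xV; rewrite !inE => /andP[].
have nxx0 : ~~ joined v x x0 by apply: contra xC => xx0; rewrite inE xV.
have d1 := separated_degree_ge2 xv x0v nxx0.
split=> //; exists v => //.
have Zd : (#|v |: Z| <= d)%N.
  apply: (block_cut_vertices_le blB).
    by apply/subsetP => z; rewrite !inE => /orP[/eqP->//|/andP[/andP[]]].
  move=> z /setU1P[->|]; first exact: (separated_cut_vertex xv x0v nxx0).
  rewrite !inE => /andP[/andP[zv zB] /andP[zV /set0Pn[u]]].
  rewrite !inE => /andP[/andP[uz _] nuv].
  by apply: (separated_cut_vertex uz _ nuv); rewrite eq_sym.
rewrite cardsU1 !inE eqxx /= in Zd.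
apply: leq_trans (leq_mul (leqnn _) (joined_pairs_le Cmax)) _.
rewrite -/m -/r -mr; apply: unbalanced_pairs_bound => //.
have {}mle : (m + r + 1 <= max_block_size e + d * r)%N.
  have B0 : (0 < #|B|)%N by rewrite (cardsD1 v B) vB.
  have arith (p q s t u : nat) : (p <= s - 1 + t * q -> (1 + t) * q <= u ->
      0 < s -> p + q + 1 <= s + u)%N by clear; lia.
  apply: leq_trans (arith _ _ _ _ _ mle (leq_mul Zd (leqnn r)) B0) _.
  by rewrite leq_add2r.
have VE : #|V| = (m + r + 1)%N by rewrite mr cardV // addn1 prednK // ltnW.
move: Vdb (leq_mul (leqnn d) mle); rewrite VE [(d * (max_block_size e + _))%N]mulnDr => Vdb dmle.
(* With [b] the largest block size, [d * b <= m + r] and [m + r + 1 <= b + d * r] give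
   [(d - 1) * (m + r) <= d ^ 2 * r], and [d <= 2 * (d - 1)]. *)
rewrite -(leq_pmul2l (m := d - 1)) ?subn_gt0 //.
have arith (c k q s : nat) : (1 < c -> c * k < q + 1 ->
    c * (q + 1) <= c * k + c * (c * s) -> (c - 1) * q <= (c - 1) * (2 * c * s))%N.
  clear; case: c => [|[|c]] // _; rewrite subSS subn0; nia.
exact: arith dmle.
Qed.

End BoundedDegree.
End Separation.

(** * Minors of a generic covariance matrix *)

Section Minors.
Variables (R : realFieldType) (n : nat).
Implicit Types (M : 'M[R]_n) (e : rel 'I_n).

Lemma mulmx_minor0 m p q (C : 'M[R]_(m, p)) (D : 'M[R]_(p, q)) i i' j j' :
  (p <= 1)%N ->
  (C *m D) i j * (C *m D) i' j' = (C *m D) i j' * (C *m D) i' j.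
Proof.
case: p C D => [|[|//]] C D _; rewrite !mxE.
  by rewrite !big_ord0.
by rewrite !big_ord1; ring.
Qed.

Lemma submx_of_minor0 M (A B : {set 'I_n}) a a' b b' :
  (\rank (submx_of M A B) <= 1)%N ->
  a \in A -> a' \in A -> b \in B -> b' \in B -> M a b * M a' b' = M a b' * M a' b.
Proof.
move=> rk aA a'A bB b'B.
have E x y (xA : x \in A) (yB : y \in B) :
    M x y = submx_of M A B (enum_rank_in xA x) (enum_rank_in yB y).
  by rewrite mxE !enum_rankK_in.
rewrite (E a b aA bB) (E a' b' a'A b'B) (E a b' aA b'B) (E a' b a'A bB).
by rewrite -(mulmx_base (submx_of M A B)); apply: mulmx_minor0.
Qed.

Lemma posdef_diag_gt0 M i : posdef M -> 0 < M i i.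
Proof.
move=> [_ /(_ (delta_mx i 0))]; rewrite trmx_delta -rowE -colE !mxE; apply.
apply/eqP => /matrixP/(_ i 0); rewrite !mxE !eqxx => /eqP.
by rewrite oner_eq0.
Qed.

Lemma separates_singleton e u v w : u != w -> v != w ->
  ~~ joined e w u v -> separates e [set w] [set u; w] [set v; w].
Proof.
move=> uw vw nuv x p ep _ xu lv; exists w; last by rewrite inE.
apply: contraR nuv => wp.
have xw : x != w by apply: contraNneq wp => ->; rewrite inE eqxx.
have lw : last x p != w by apply: contraNneq wp => <-; apply: mem_last.
move: xu lv; rewrite !inE (negPf xw) (negPf lw) !orbF => /eqP<- /eqP<-.
apply: path_connect_rel_in ep _ (mem_last _ _) => y yp.
by rewrite !inE; apply: contraNneq wp => <-.
Qed.

(** The single-vertex path at [w] forces [w] into [S], so [S] is [w] alone, and a path joining [u]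
    and [v] off [w] misses it. *)
Lemma separates_joined e S u v w : u != w -> v != w ->
  separates e S [set u; w] [set v; w] -> (#|S| <= 1)%N -> ~~ joined e w u v.
Proof.
move=> uw vw sep S1.
have wS : w \in S.
  by have [||z] := sep w [::] isT isT; rewrite !inE ?eqxx ?orbT // => /eqP->.
apply/negP => /connectP[p0 /shortenP[p pp up _] vE].
have [|||z zp zS] := sep u p _ up.
- by apply: sub_path pp => x y /and3P[].
- by rewrite !inE eqxx.
- by rewrite -vE !inE eqxx.
have zw : z = w by apply: (card_le1_eqP S1).
have : z \in ~: [set w].
  apply: connect_rel_in_mem (path_connect pp zp) _.
  by rewrite !inE.
by rewrite zw !inE eqxx.
Qed.

(** Both index sets contain [w], so by genericity the rank is at most 1 exactly when [w] alone
    separates them. The minor detects this because [M w w] is a nonzero pivot. The case [u = v] is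
    included. *)
Lemma minor_joined M e u v w :
  posdef M -> generic e M -> u != w -> v != w ->
  (M u v * M w w - M u w * M v w != 0) = joined e w u v.
Proof.
move=> pM gM uw vw; have [Msym _] := pM.
have Mww : M w w != 0 by rewrite gt_eqF // posdef_diag_gt0.
have MC i j : M i j = M j i by rewrite -[in LHS]Msym mxE.
have [[S sepS cardS] minS] := gM [set u; w] [set v; w].
rewrite subr_eq0 [M v w]MC; apply/idP/idP.
  apply: contraR => /(separates_singleton uw vw)/minS; rewrite cards1 => rk.
  by rewrite (submx_of_minor0 rk) // !inE eqxx ?orbT.
apply: contraTN => /eqP minor0; apply: separates_joined uw vw sepS _.
rewrite cardS.
pose c : 'cV[R]_#|[set u; w]| := \col_i (M (enum_val i) w / M w w).
pose r : 'rV[R]_#|[set v; w]| := \row_j M w (enum_val j).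
suff -> : submx_of M [set u; w] [set v; w] = c *m r by apply: mulmx_max_rank.
apply/matrixP => i j; rewrite !mxE big_ord1 !mxE mulrAC.
apply: (canRL (mulfK Mww)).
have := enum_valP j; have := enum_valP i.
move: (enum_val i) (enum_val j) => a b; rewrite !inE.
by move=> /orP[]/eqP-> /orP[]/eqP->; rewrite // mulrC.
Qed.

End Minors.

(** * Failure probabilities and costs of programs *)

Section Ensures.
Variables (R : realType) (n : nat) (Sigma : 'M[R]_n).
Implicit Types (q t cq ct : nat) (eta : R).

Lemma ler_natb (b b' : bool) : (b -> b') -> b%:R <= b'%:R :> R.
Proof. by case: b b' => [] [] // /(_ isT). Qed.

Lemma expect_bind A B (p : prog R n A) (g : A -> prog R n B) f q t :
  expect Sigma f (bind p g) q t =
  expect Sigma (fun a q' t' => expect Sigma f (g a) q' t') p q t.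
Proof.
elim: p q t => [a||i j k IH|p IH|V k IH] q t //=.
by congr (_ / _); apply: eq_bigr => v _; rewrite IH.
Qed.

Lemma le_expect A (p : prog R n A) f g q t :
  (forall a q' t', f a q' t' <= g a q' t') ->
  expect Sigma f p q t <= expect Sigma g p q t.
Proof.
move=> fg; elim: p q t => [a||i j k IH|p IH|V k IH] q t //=.
by rewrite ler_wpM2r ?invr_ge0 ?ler0n //; apply: ler_sum => v _; apply: IH.
Qed.

Lemma eq_expect A (p : prog R n A) f g q t :
  (forall a q' t', f a q' t' = g a q' t') ->
  expect Sigma f p q t = expect Sigma g p q t.
Proof. by move=> fg; apply/eqP; rewrite eq_le !le_expect // => *; rewrite fg. Qed.

Lemma expectZ A (p : prog R n A) c f q t :
  expect Sigma (fun a q' t' => c * f a q' t') p q t = c * expect Sigma f p q t.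
Proof.
elim: p q t => [a||i j k IH|p IH|V k IH] q t //=; first by rewrite mulr0.
by rewrite mulrA mulr_sumr; congr (_ / _); apply: eq_bigr => v _; apply: IH.
Qed.

Lemma expectD A (p : prog R n A) f g q t :
  expect Sigma (fun a q' t' => f a q' t' + g a q' t') p q t =
  expect Sigma f p q t + expect Sigma g p q t.
Proof.
elim: p q t => [a||i j k IH|p IH|V k IH] q t //=; first by rewrite addr0.
by rewrite -mulrDl -big_split; congr (_ / _); apply: eq_bigr => v _; apply: IH.
Qed.

Lemma expectB A (p : prog R n A) f g q t :
  expect Sigma (fun a q' t' => f a q' t' - g a q' t') p q t =
  expect Sigma f p q t - expect Sigma g p q t.
Proof.
rewrite -mulN1r -expectZ -expectD; apply: eq_expect => a q' t'.
by rewrite mulN1r.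
Qed.

(** Only an inequality: [Fail] contributes 0, and so does a draw from the empty set, where division
    by 0 gives 0. *)
Lemma expect_cst_le A (p : prog R n A) c q t :
  0 <= c -> expect Sigma (fun _ _ _ => c) p q t <= c.
Proof.
move=> c0; elim: p q t => [a||i j k IH|p IH|V k IH] q t //=.
have [V0|V0] := posnP #|V|; first by rewrite V0 invr0 mulr0.
rewrite ler_pdivrMr ?ltr0n // mulr_natr -sumr_const.
by apply: ler_sum => v _; apply: IH.
Qed.

Lemma expect_ge0 A (p : prog R n A) f q t :
  (forall a q' t', 0 <= f a q' t') -> 0 <= expect Sigma f p q t.
Proof.
move=> f0; elim: p q t => [a||i j k IH|p IH|V k IH] q t //=.
by rewrite divr_ge0 ?ler0n //; apply: sumr_ge0 => v _; apply: IH.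
Qed.

(** The bounds are increments over arbitrary initial counters, so that they add up under [bind];
    runs ending in [Fail] count towards [eta]. *)
Definition ensures A (p : prog R n A) (Q : A -> Prop) cq ct eta : Prop :=
  forall q t, 1 - eta <= expect Sigma (fun a q' t' =>
    ([&& `[< Q a >], q' <= q + cq & t' <= t + ct]%N)%:R) p q t.

Lemma ensures_weaken A (p : prog R n A) (Q Q' : A -> Prop)
    cq cq' ct ct' eta eta' :
  (forall a, Q a -> Q' a) -> (cq <= cq')%N -> (ct <= ct')%N -> eta <= eta' ->
  ensures p Q cq ct eta -> ensures p Q' cq' ct' eta'.
Proof.
move=> QQ qq tt ee H q t; apply: (le_trans _ (le_trans (H q t) _)).
  by rewrite lerD2l lerN2.
apply: le_expect => a q' t'; apply: ler_natb => /and3P[/asboolP Qa qle tle]; apply/and3P; split.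
- by apply/asboolP; apply: QQ.
- by apply: leq_trans qle _; rewrite leq_add2l.
- by apply: leq_trans tle _; rewrite leq_add2l.
Qed.

Lemma ensures_err_ge0 A (p : prog R n A) Q cq ct eta :
  ensures p Q cq ct eta -> 0 <= eta.
Proof.
move=> /(_ 0 0)%N H; have : 1 - eta <= 1; last by rewrite gerBl.
apply: (le_trans H); apply: (le_trans (@le_expect _ _ _ (fun _ _ _ => 1) _ _ _)).
  by move=> a q t; rewrite lern1 leq_b1.
exact: expect_cst_le.
Qed.

Lemma ensures_ret A (a : A) (Q : A -> Prop) cq ct :
  Q a -> ensures (Ret a) Q cq ct 0.
Proof. by move=> Qa q t /=; rewrite asboolT // !leq_addr subr0. Qed.

Lemma ensures_query A i j (k : R -> prog R n A) Q cq ct eta :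
  ensures (k (Sigma i j)) Q cq ct eta -> ensures (Query i j k) Q cq.+1 ct.+1 eta.
Proof.
by move=> H q t /=; rewrite !addnS -!addSn; apply: H.
Qed.

Lemma ensures_tick A (p : prog R n A) Q cq ct eta :
  ensures p Q cq ct eta -> ensures (Tick p) Q cq ct.+1 eta.
Proof. by move=> H q t /=; rewrite addnS -addSn; apply: H. Qed.

Lemma ensures_sample A V (k : 'I_n -> prog R n A) Q cq ct eta :
  V != set0 -> {in V, forall v, ensures (k v) Q cq ct eta} ->
  ensures (Sample V k) Q cq ct.+1 eta.
Proof.
move=> V0 H q t /=; rewrite ler_pdivlMr ?ltr0n ?card_gt0 // mulr_natr -sumr_const.
by apply: ler_sum => v vV; rewrite addnS -addSn; apply: H.
Qed.

Lemma ensures_bind A B (p : prog R n A) (g : A -> prog R n B)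
    (Q : A -> Prop) (Q' : B -> Prop) cq cq' ct ct' eta eta' :
  0 <= eta' ->
  ensures p Q cq ct eta -> (forall a, Q a -> ensures (g a) Q' cq' ct' eta') ->
  ensures (bind p g) Q' (cq + cq') (ct + ct') (eta + eta').
Proof.
move=> eta'0 Hp Hg q t; rewrite expect_bind; have eta0 := ensures_err_ge0 Hp.
(* Errors add by [(1 - eta') * (1 - eta) >= 1 - eta - eta']. The multiplication needs [1 - eta']
   positive; otherwise the claimed lower bound is at most 0. *)
have [le0|gt0] := lerP (1 - eta') 0.
  apply: (@le_trans _ _ 0); first by lra.
  by apply: expect_ge0 => a q' t'; apply: expect_ge0 => *; rewrite ler0n.
apply: (@le_trans _ _ ((1 - eta') * (1 - eta))); first by nra.
apply: (le_trans (ler_wpM2l (ltW gt0) (Hp q t))); rewrite -expectZ.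
apply: le_expect => a q' t'.
have [/and3P[/asboolP Qa qle tle]|_] := boolP [&& _, _ & _]; last first.
  by rewrite mulr0; apply: expect_ge0 => *; rewrite ler0n.
rewrite mulr1; apply: (le_trans (Hg a Qa q' t')).
apply: le_expect => b q2 t2; apply: ler_natb => /and3P[-> q2le t2le] /=.
rewrite !addnA (leq_trans q2le) ?leq_add2r //.
by rewrite (leq_trans t2le) ?leq_add2r.
Qed.

Lemma ensures_bind0 A B (p : prog R n A) (g : A -> prog R n B)
    (Q : A -> Prop) (Q' : B -> Prop) cq cq' ct ct' :
  ensures p Q cq ct 0 -> (forall a, Q a -> ensures (g a) Q' cq' ct' 0) ->
  ensures (bind p g) Q' (cq + cq') (ct + ct') 0.
Proof. by rewrite -[X in _ -> _ -> ensures _ _ _ _ X](addr0 0); apply: ensures_bind. Qed.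

Lemma ensures_bind_ret A B (p : prog R n A) (h : A -> B) (Q : B -> Prop) cq ct eta :
  ensures p (fun a => Q (h a)) cq ct eta ->
  ensures (bind p (fun a => Ret (h a))) Q cq ct eta.
Proof.
move=> H; rewrite -[cq]addn0 -[ct]addn0 -[eta]addr0.
by apply: (ensures_bind (lexx 0) H) => a Qa; apply: ensures_ret.
Qed.

(** The invariant sees the processed prefix, as the growing parts of [ComponentsSB] require; the
    bounds vary with the item, as the recursion over parts requires. *)
Lemma ensures_foldM S I (f : S -> I -> prog R n S) (Inv : seq I -> S -> Prop)
    (cq ct : I -> nat) (eta : I -> R) s r :
  (forall x, 0 <= eta x) ->
  (forall pre x post s', r = pre ++ x :: post -> Inv pre s' ->
     ensures (f s' x) (Inv (rcons pre x)) (cq x) (ct x) (eta x)) ->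
  Inv [::] s ->
  ensures (foldM f s r) (Inv r)
    (\sum_(x <- r) cq x) (\sum_(x <- r) ct x) (\sum_(x <- r) eta x).
Proof.
move=> eta0 H Is; suff main post : forall pre s', r = pre ++ post -> Inv pre s' ->
    ensures (foldM f s' post) (Inv r)
      (\sum_(x <- post) cq x) (\sum_(x <- post) ct x) (\sum_(x <- post) eta x).
  exact: main Is.
elim: post => [|x post IH] pre s' rE Is' /=.
  by rewrite !big_nil; apply: ensures_ret; rewrite rE cats0.
rewrite !big_cons; apply: ensures_bind; first by apply: sumr_ge0.
  exact: H rE Is'.
by move=> s2; apply: IH; rewrite cat_rcons.
Qed.

Lemma ensures_and A (p : prog R n A) (Q Q' : A -> Prop) cq ct eta eta' :
  ensures p Q cq ct eta -> ensures p Q' cq ct eta' ->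
  ensures p (fun a => Q a /\ Q' a) cq ct (eta + eta').
Proof.
move=> H H' q t; have one := @expect_cst_le _ p 1 q t ler01.
apply: (@le_trans _ _ (1 - eta + (1 - eta') - 1)); first by lra.
apply: (le_trans (lerB (lerD (H q t) (H' q t)) one)).
rewrite -expectD -expectB; apply: le_expect => a q' t'.
have -> : `[< Q a /\ Q' a >] = `[< Q a >] && `[< Q' a >].
  by apply/asboolP/andP => -[]; [move=> /asboolP + /asboolP | move=> /asboolP + /asboolP].
by case: `[< Q a >] `[< Q' a >] (_ <= _)%N (_ <= _)%N => [] [] [] [] /=; lra.
Qed.

(** The indicator of low cost minus [g] is at most the indicator of low cost together with [Q]. *)
Lemma ensures_markov A (p : prog R n A) (Q : A -> Prop) (g : A -> R) cq ct eta :
  (forall a, 0 <= g a) -> (forall a, ~ Q a -> 1 <= g a) ->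
  (forall q t, expect Sigma (fun a _ _ => g a) p q t <= eta) ->
  ensures p (fun=> True) cq ct 0 -> ensures p Q cq ct eta.
Proof.
move=> g0 g1 gE H q t.
apply: (@le_trans _ _ (1 - 0 - eta)); first by lra.
apply: (le_trans (lerB (H q t) (gE q t))).
rewrite -expectB; apply: le_expect => a q' t'.
rewrite asboolT //; case: asboolP => [_|/g1 ga].
  by rewrite gerBl.
by move: (g0 a) ga; case: (_ <= _)%N (_ <= _)%N => [] [] /=; lra.
Qed.

End Ensures.

(** * The algorithm *)

Section Hoeffding.
Variable R : realType.

(** Squaring [1 - x / 2 <= expR (- (x / 2))] bounds [expR x] by the inverse of [(1 - x / 2) ^+ 2],
    which is at most the quadratic for these [x]. *)
Lemma expR_le_quadratic (x : R) : `|x| <= 1 / 4 -> expR x <= 1 + x + x ^+ 2.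
Proof.
rewrite ler_norml => /andP[x1 x2].
have y1 : 1 - x / 2 <= expR (- (x / 2)).
  by have := expR_ge1Dx (- (x / 2)).
have e0 := expR_gt0 x.
have xE : expR x * expR (- (x / 2)) ^+ 2 = 1.
  by rewrite expr2 -!expRD -[RHS]expR0; congr expR; field.
have pos : 0 < 1 - x / 2 by lra.
have : expR x * (1 - x / 2) ^+ 2 <= 1.
  rewrite -[leRHS]xE; apply: ler_wpM2l; first exact: ltW.
  by apply: lerXn2r y1; rewrite nnegrE ?expR_ge0 // ltW.
have : 1 <= (1 + x + x ^+ 2) * (1 - x / 2) ^+ 2.
  have -> : (1 + x + x ^+ 2) * (1 - x / 2) ^+ 2 =
    1 + (x ^+ 2) * ((1 - 3 * x + x ^+ 2) / 4) by field.
  by rewrite lerDl mulr_ge0 ?sqr_ge0 //; have := sqr_ge0 x; lra.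
move=> h1 h2; have := le_trans h2 h1.
by rewrite ler_pM2r // exprn_gt0.
Qed.

(** After centring, the linear terms cancel and the quadratic ones sum to [l ^+ 2 * p * (1 - p)], at
    most [l ^+ 2 / 4]. *)
Lemma bernoulli_mgf (p l : R) : 0 <= p <= 1 -> `|l| <= 1 / 4 ->
  (1 - p) + p * expR l <= expR (l * p + l ^+ 2 / 4).
Proof.
move=> /andP[p0 p1] l4.
have small x : 0 <= x <= 1 -> `|l * x| <= 1 / 4.
  move=> /andP[x0 x1]; rewrite normrM (ger0_norm x0).
  by apply: le_trans l4; rewrite ler_piMr.
have q1 : 0 <= 1 - p <= 1 by rewrite subr_ge0 p1 gerBl.
have := expR_le_quadratic (small (1 - p) q1).
have : expR (l * - p) <= 1 + l * - p + (l * - p) ^+ 2.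
  by apply: expR_le_quadratic; rewrite mulrN normrN small // p0.
move=> h1 h2.
have E : (1 - p) + p * expR l =
    ((1 - p) * expR (l * - p) + p * expR (l * (1 - p))) * expR (l * p).
  rewrite mulrDl -!mulrA -!expRD; congr (_ + _ * _).
    by rewrite mulrN addNr expR0 mulr1.
  by congr expR; ring.
rewrite {}E mulrC expRD; apply: ler_wpM2l; first exact: expR_ge0.
apply: (le_trans _ (expR_ge1Dx _)).
have {}h1 : (1 - p) * expR (l * - p) <= (1 - p) * (1 + l * - p + (l * - p) ^+ 2).
  by apply: ler_wpM2l h1; rewrite subr_ge0.
have {}h2 := ler_wpM2l p0 h2.
apply: (le_trans (lerD h1 h2)).
rewrite -subr_ge0.
have -> : 1 + l ^+ 2 / 4 - ((1 - p) * (1 + l * - p + (l * - p) ^+ 2) +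
    p * (1 + l * (1 - p) + (l * (1 - p)) ^+ 2)) =
    l ^+ 2 * (p - 1 / 2) ^+ 2 by field.
by rewrite mulr_ge0 ?sqr_ge0.
Qed.

End Hoeffding.

(** * Costs and accuracy of the subroutines *)

Section Algorithm.
Variables (R : realType) (n : nat) (e : rel 'I_n) (Sigma : 'M[R]_n).
Hypothesis e_simple : simple_graph e.
Hypothesis Sigma_posdef : posdef Sigma.
Hypothesis Sigma_generic : generic e Sigma.

Lemma ensures_minor_ne0 a b c d :
  ensures Sigma (minor_ne0 R a b c d)
    (fun r => r = (Sigma a.1 a.2 * Sigma b.1 b.2 - Sigma c.1 c.2 * Sigma d.1 d.2 != 0))
    4 8 0.
Proof.
do 4 apply: ensures_query; do 4 apply: ensures_tick.
exact: ensures_ret.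
Qed.

(** The probability that two independent uniform draws from [V :\ v] are joined at [v], which is
    what [s_hat] estimates. *)
Definition joined_freq (V : {set 'I_n}) v : R :=
  (joined_pairs e V v)%:R / #|V :\ v|%:R ^+ 2.

Lemma minor_joined_sym u v w : u != v -> w != v ->
  (Sigma u v * Sigma v w - Sigma u w * Sigma v v != 0) = joined e v u w.
Proof.
move=> uv wv; rewrite -(minor_joined Sigma_posdef Sigma_generic uv wv).
have [Ssym _] := Sigma_posdef.
have -> : Sigma v w = Sigma w v by rewrite -[in LHS]Ssym mxE.
by rewrite -oppr_eq0 opprB.
Qed.

Definition s_hat_step (inc : R) (V : {set 'I_n}) (v : 'I_n) (s : R) : prog R n R :=
  let! u := sample R (V :\ v) in
  let! w := sample R (V :\ v) in
  let! b := minor_ne0 R (u, v) (v, w) (u, w) (v, v) in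
  if b then addM n s inc else Ret s.

Lemma expect_s_hat_step inc V v s (h : R -> R) q t :
  (0 < #|V :\ v|)%N ->
  expect Sigma (fun a _ _ => h a) (s_hat_step inc V v s) q t =
  (1 - joined_freq V v) * h s + joined_freq V v * h (s + inc).
Proof.
move=> V0 /=.
have M0 : #|V :\ v|%:R != 0 :> R by rewrite pnatr_eq0 -lt0n.
pose J u w : R := (joined e v u w)%:R.
transitivity ((\sum_(u in V :\ v) (\sum_(w in V :\ v)
    (h s + J u w * (h (s + inc) - h s))) / #|V :\ v|%:R) / #|V :\ v|%:R).
  congr (_ / _); apply: eq_bigr => u; rewrite inE in_set1 => /andP[uv _].
  congr (_ / _); apply: eq_bigr => w; rewrite inE in_set1 => /andP[wv _].
  rewrite minor_joined_sym // /J; case: joined => /=; by [ring | rewrite mul0r addr0].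
have JE : \sum_(u in V :\ v) \sum_(w in V :\ v) J u w = (joined_pairs e V v)%:R.
  rewrite /joined_pairs natr_sum; apply: eq_bigr => u _.
  rewrite -sum1_card natr_sum (eq_bigl (fun w => (w \in V :\ v) && joined e v w u)).
    rewrite big_mkcondr; apply: eq_bigr => w _.
    by rewrite /J joined_sym //; case: joined.
  by move=> w; rewrite !inE.
rewrite -mulr_suml.
have -> : \sum_(u in V :\ v) \sum_(w in V :\ v) (h s + J u w * (h (s + inc) - h s))
   = #|V :\ v|%:R ^+ 2 * h s + (joined_pairs e V v)%:R * (h (s + inc) - h s).
  under eq_bigr => u _ do rewrite big_split /= sumr_const -mulr_suml.
  rewrite big_split /= sumr_const -mulr_suml JE; congr (_ + _).
  by rewrite -mulrnA -[LHS]mulr_natl natrM expr2.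
rewrite /joined_freq; move: (#|_|%:R : R) (joined_pairs _ _ _)%:R M0 => M P M0.
by field.
Qed.

Lemma joined_freq_itv V v : (0 < #|V :\ v|)%N -> 0 <= joined_freq V v <= 1.
Proof.
move=> V0; rewrite /joined_freq divr_ge0 ?ler0n ?exprn_ge0 //=.
rewrite ler_pdivrMr ?exprn_gt0 ?ltr0n // mul1r -natrX ler_nat.
rewrite -mulnn -sum_nat_const; apply: leq_sum => u _.
by apply: subset_leq_card; apply/subsetP => x; rewrite inE => /andP[].
Qed.

(** The rounds are independent, so each contributes one Bernoulli factor to the exponential
    moment. *)
Lemma expect_s_hat_exp inc V v th k s c q t :
  (0 < #|V :\ v|)%N -> let p := joined_freq V v in
  expect Sigma (fun a _ _ => c * expR (th * a)) (Defs.iterM k (s_hat_step inc V v) s) q t =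
  c * expR (th * s) * (1 - p + p * expR (th * inc)) ^+ k.
Proof.
move=> V0 p; elim: k s q t => [|k IH] s q t; first by rewrite expr0 mulr1.
rewrite -[Defs.iterM _ _ _]/(bind (s_hat_step inc V v s)
  (Defs.iterM k (s_hat_step inc V v))) expect_bind.
rewrite (eq_expect _ _ _ _ (fun a q' t' => IH a q' t')).
rewrite (@expect_s_hat_step inc V v s (fun a => c * expR (th * a) *
  (1 - p + p * expR (th * inc)) ^+ k)) // -/p.
by rewrite mulrDr expRD exprS; ring.
Qed.

Lemma ensures_s_hat_step inc V v s : (0 < #|V :\ v|)%N ->
  ensures Sigma (s_hat_step inc V v s) (fun=> True) 4 11 0.
Proof.
rewrite card_gt0 => V0.
apply: (@ensures_sample _ _ _ _ (V :\ v) _ _ 4 10) => // u _.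
apply: (@ensures_sample _ _ _ _ (V :\ v) _ _ 4 9) => // w _ /=.
do 4 apply: ensures_query; do 4 apply: ensures_tick.
by case: ifP => _; [apply: ensures_tick|]; apply: ensures_ret.
Qed.

Lemma ensures_iterM S k (f : S -> prog R n S) cq ct s :
  (forall s, ensures Sigma (f s) (fun=> True) cq ct 0) ->
  ensures Sigma (Defs.iterM k f s) (fun=> True) (k * cq) (k * ct) 0.
Proof.
move=> H; elim: k s => [|k IH] s; first exact: ensures_ret.
rewrite !mulSn -[0 in X in ensures _ _ _ _ _ X](addr0 0).
by apply: (ensures_bind (lexx 0)) (H s) _ => a _; apply: IH.
Qed.

(* Hoeffding's inequality, from the exponential moments of the Bernoulli
   increments with parameter [l = 2 delta] for the upper tail and
   [l = - 2 delta] for the lower one. *)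
Lemma ensures_s_hat kappa V v delta :
  (0 < #|V :\ v|)%N -> (0 < kappa)%N -> 0 < delta <= 1 / 8 ->
  ensures Sigma (s_hat R kappa V v) (fun s => `|s - joined_freq V v| < delta)
    (kappa * 4) (kappa * 11).+1 (2 * expR (- (kappa%:R * delta ^+ 2))).
Proof.
move=> V0 k0 /andP[d0 d8]; set p := joined_freq V v.
have kR : kappa%:R != 0 :> R by rewrite pnatr_eq0 -lt0n.
rewrite -[s_hat _ _ _ _]/(Tick (Defs.iterM kappa (s_hat_step (1 / kappa%:R) V v) 0)).
apply: ensures_tick.
have costs := @ensures_iterM _ kappa _ _ _ 0
  (fun s => @ensures_s_hat_step (1 / kappa%:R) V v s V0).
have tail l : l ^+ 2 = 4 * delta ^+ 2 -> `|l| <= 1 / 4 ->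
    ensures Sigma (Defs.iterM kappa (s_hat_step (1 / kappa%:R) V v) 0)
    (fun s => l * (s - p) < 2 * delta ^+ 2) (kappa * 4) (kappa * 11)
    (expR (- (kappa%:R * delta ^+ 2))).
  (* Markov's inequality for the exponential of [kappa * (l * (s - p) - 2 * delta ^ 2)]; as
     [l ^ 2 / 4 = delta ^ 2], its mean is at most that of [- kappa * delta ^ 2]. *)
  move=> l2 l4; pose c := expR (- (kappa%:R * (l * p + 2 * delta ^+ 2))).
  apply: (@ensures_markov _ _ _ _ _ _
    (fun s => c * expR (kappa%:R * l * s))) costs.
  - by move=> a; rewrite mulr_ge0 ?expR_ge0.
  - move=> a /negP; rewrite -leNgt => le; rewrite /c -expRD -[leLHS]expR0 ler_expR.
    have -> : - (kappa%:R * (l * p + 2 * delta ^+ 2)) + kappa%:R * l * a =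
      kappa%:R * (l * (a - p) - 2 * delta ^+ 2) by ring.
    by rewrite mulr_ge0 ?ler0n // subr_ge0.
  - move=> q t; rewrite expect_s_hat_exp // mulr0 expR0 mulr1 -/p.
    have -> : kappa%:R * l * (1 / kappa%:R) = l by field.
    have := bernoulli_mgf (joined_freq_itv V0) l4; rewrite -/p => mgf.
    have p01 := joined_freq_itv V0.
    apply: (@le_trans _ _ (c * expR (l * p + l ^+ 2 / 4) ^+ kappa)).
      apply: ler_wpM2l; first exact: expR_ge0.
      apply: lerXn2r mgf; rewrite nnegrE ?expR_ge0 //.
      case/andP: p01 => p0 p1.
      by rewrite addr_ge0 ?subr_ge0 // mulr_ge0 ?expR_ge0.
    rewrite -expRM_natl /c -expRD ler_expR l2 le_eqVlt; apply/orP; left; apply/eqP.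
    by field.
have up := tail (2 * delta); have lo := tail (- (2 * delta)).
rewrite mulr_natl mulr2n.
apply: (ensures_weaken _ (leqnn _) (leqnn _) (lexx _) (ensures_and (up _ _) (lo _ _))).
- move=> a [ha la]; rewrite ltr_norml; apply/andP; split.
    have : delta * (- delta) < delta * (a - p) by rewrite expr2 in la ha *; lra.
    by rewrite ltr_pM2l.
  have : delta * (a - p) < delta * delta by rewrite expr2 in la ha *; lra.
  by rewrite ltr_pM2l.
- by rewrite exprMn; lra.
- by rewrite ger0_norm; lra.
- by rewrite sqrrN exprMn; lra.
- by rewrite normrN ger0_norm; lra.
Qed.

Lemma ensures_argminM (r : seq ('I_n * R)) : r != [::] ->
  ensures Sigma (argminM r)
    (fun v => exists s, (v, s) \in r /\ {in r, forall z, s <= z.2}) 0 (size r) 0.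
Proof.
case: r => [//|x r] _ /=.
pose Inv (pre : seq ('I_n * R)) (y : 'I_n * R) :=
  y \in x :: pre /\ {in x :: pre, forall z, y.2 <= z.2}.
have main := @ensures_foldM _ _ Sigma _ _ (fun y z : 'I_n * R =>
  let! b := ltM n z.2 y.2 in Ret (if b then z else y)) Inv (fun=> 0%N) (fun=> 1%N)
  (fun=> 0) x r.
apply: ensures_bind_ret; apply: ensures_weaken (main _ _ _) => //.
- by move=> [v s] [vr vmin]; exists s.
- by rewrite big1.
- by rewrite sum1_size.
- by rewrite big1.
- move=> pre z post y _ [yp ymin] /=; apply: ensures_tick; apply: ensures_ret.
  split; first by rewrite -rcons_cons mem_rcons inE; case: ifP; rewrite ?eqxx ?yp ?orbT.
  move=> z'; rewrite -rcons_cons mem_rcons inE => /predU1P[->|/ymin].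
    by case: ltP.
  by case: ifP => // /ltW; apply: le_trans.
- by split; rewrite ?inE ?eqxx // => z; rewrite inE => /eqP->.
Qed.

(** Two errors of [delta] enter the comparison of the chosen vertex with any other, and the union
    bound runs over the estimates. Per vertex the time is [kappa * 11], one division and one
    comparison. *)
Lemma ensures_sCentral kappa (V : {set 'I_n}) (delta : R) :
  (1 < #|V|)%N -> (0 < kappa)%N -> 0 < delta <= 1 / 8 ->
  ensures Sigma (sCentral R kappa V)
    (fun w => w \in V /\ {in V, forall v, joined_freq V w < joined_freq V v + 2 * delta})
    (#|V| * (kappa * 4)) (#|V| * (kappa * 11).+2)
    (#|V|%:R * (2 * expR (- (kappa%:R * delta ^+ 2)))).
Proof.
move=> V1 k0 d8.
pose Inv (pre : seq 'I_n) (r : seq ('I_n * R)) :=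
  [seq z.1 | z <- r] = pre /\ {in r, forall z, `|z.2 - joined_freq V z.1| < delta}.
have main := @ensures_foldM _ _ Sigma _ _ (fun (r : seq ('I_n * R)) v =>
    let! s := s_hat R kappa V v in Ret (rcons r (v, s))) Inv
  (fun=> (kappa * 4)%N) (fun=> (kappa * 11).+1%N)
  (fun=> 2 * expR (- (kappa%:R * delta ^+ 2))) [::] (enum V).
have costE : (#|V| * (kappa * 11).+2 = #|V| * (kappa * 11).+1 + #|V|)%N.
  by rewrite mulnS addnC.
rewrite costE -[(#|V| * (kappa * 4))%N]addn0 -[X in ensures _ _ _ _ _ X]addr0.
apply: (ensures_bind (lexx 0) (Q := Inv (enum V))).
  apply: ensures_weaken (main _ _ _) => //.
  - by rewrite big_enum /= sum_nat_const.
  - by rewrite big_enum /= sum_nat_const.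
  - by rewrite big_enum /= sumr_const [leRHS]mulr_natl.
  - by move=> _; rewrite mulr_ge0 ?expR_ge0.
  - move=> pre v post r VE [rE rd].
    have vV : v \in V by rewrite -mem_enum VE mem_cat mem_head orbT.
    have V0 : (0 < #|V :\ v|)%N by rewrite (cardsD1 v) vV in V1.
    apply: ensures_bind_ret; apply: ensures_weaken (ensures_s_hat V0 k0 d8) => // s sd.
    split; first by rewrite map_rcons rE.
    by move=> z; rewrite mem_rcons inE => /predU1P[->|/rd].
move=> r [rE rd].
have szr : size r = #|V| by rewrite cardE -rE size_map.
rewrite -szr; apply: ensures_weaken (ensures_argminM _) => //; last first.
  by rewrite -size_eq0 szr -lt0n ltnW.
move=> w [s [wr smin]]; split.
  by rewrite -mem_enum -rE; apply/mapP; exists (w, s).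
move=> v; rewrite -mem_enum -rE => /mapP[[v' sv] vr ->] /=.
have := rd _ wr; have := rd _ vr; have := smin _ vr => /=.
by rewrite !ltr_norml => h /andP[h1 h2] /andP[h3 h4]; clear main rE rd; lra.
Qed.

Lemma ensures_find_mate w u (N : seq 'I_n) : u != w -> w \notin N ->
  ensures Sigma (find_mate R w u N)
    (fun o => if o is Some v then v \in N /\ joined e w u v
              else {in N, forall v, ~~ joined e w u v})
    (size N * 4) (size N * 8) 0.
Proof.
move=> uw; elim: N => [|v N IH] wN; first exact: ensures_ret.
move: wN; rewrite inE negb_or => /andP[wv wN].
rewrite -[find_mate _ _ _ _]/(let! b := minor_ne0 R (u, v) (w, w) (u, w) (v, w) in
  if b then Ret (Some v) else find_mate R w u N).
rewrite [size _]/= !mulSn.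
apply: (ensures_bind0 (ensures_minor_ne0 _ _ _ _)) => b /= ->.
rewrite (minor_joined Sigma_posdef Sigma_generic uw) 1?eq_sym //.
case: ifP => uv; first by apply: ensures_ret; rewrite mem_head.
apply: ensures_weaken (IH wN) => // -[v'|] => [[v'N uv']|none].
  by rewrite inE v'N orbT.
by move=> v'; rewrite inE => /predU1P[->|/none]; rewrite ?uv.
Qed.

Lemma ensures_foldM_cst S I (f : S -> I -> prog R n S) cq ct s r :
  (forall s x, ensures Sigma (f s x) (fun=> True) cq ct 0) ->
  ensures Sigma (foldM f s r) (fun=> True) (size r * cq) (size r * ct) 0.
Proof.
move=> H; elim: r s => [|x r IH] s; first exact: ensures_ret.
rewrite [size _]/= !mulSn.
by apply: (ensures_bind0 (H s x)) => a _; apply: IH.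
Qed.

Lemma ensures_tabulateM m p (F : 'I_m -> 'I_p -> prog R n R) cq ct :
  (forall i j, ensures Sigma (F i j) (fun=> True) cq ct 0) ->
  ensures Sigma (tabulateM F) (fun=> True) (m * p * cq) (m * p * ct) 0.
Proof.
move=> H; have -> : (m * p = size (enum {: 'I_m * 'I_p}))%N.
  by rewrite -cardE card_prod !card_ord.
by apply: ensures_foldM_cst => M ij; apply: ensures_bind_ret; apply: H.
Qed.

Lemma ensures_eliminateM m (M : 'M[R]_(m, m + m)) k :
  ensures Sigma (eliminateM n M k) (fun=> True) 0 (m * (m + m) * 3) 0.
Proof.
rewrite -[3%N]/(1 + 2)%N mulnDr -[0%N]/(0 + 0)%N -(muln0 (m * (m + m))).
apply: (ensures_bind0 (Q := fun=> True)) => [|M1 _]; apply: ensures_tabulateM => i j.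
  by case: ifP => _; [apply: ensures_tick|]; apply: ensures_ret.
by case: ifP => _; [|do 2 apply: ensures_tick]; apply: ensures_ret.
Qed.

(** Reading and testing entries costs at most [m ^ 2] each; each of the [m] elimination steps spends
    at most 3 operations per entry of an [m] by [2 * m] matrix. *)
Lemma ensures_conc_edges V :
  ensures Sigma (conc_edges R V) (fun=> True) (#|V| ^ 2) (2 * #|V| ^ 2 + 6 * #|V| ^ 3) 0.
Proof.
set m := #|V|.
have costE : (2 * m ^ 2 + 6 * m ^ 3 = m * m * 1 + (m * (m * (m + m) * 3) + m ^ 2 * 1))%N.
  by rewrite !expnS expn0; ring.
rewrite costE -[(m ^ 2)%N in X in ensures _ _ _ X _]addn0.
rewrite -[(m ^ 2)%N in X in ensures _ _ _ X _]muln1.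
rewrite -[in X in ensures _ _ _ X _]mulnn.
apply: (ensures_bind0 (Q := fun=> True)) => [|S _].
  by apply: ensures_tabulateM => i j; apply: ensures_query; apply: ensures_ret.
rewrite -[0%N]/(0 + 0)%N; apply: (ensures_bind0 (Q := fun=> True)) => [|K _].
  apply: ensures_bind_ret.
  have := @ensures_foldM_cst _ _ (@eliminateM R n m) 0 (m * (m + m) * 3)
    (row_mx S 1%:M) (enum 'I_m) (fun M k => ensures_eliminateM M k).
  by rewrite muln0 -cardE card_ord.
apply: (ensures_weaken _ _ _ (lexx 0) (@ensures_foldM_cst _ _ _ 0 1 _ _ _)) => //.
- by rewrite muln0.
- rewrite !muln1 size_filter (leq_trans (count_size _ _)) //.
  by rewrite -cardE card_prod card_ord.
- by move=> E ij; apply: ensures_tick; apply: ensures_ret.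
Qed.

(** * Splitting into components, and the recursion *)

Section BoundedDegree.
Variable d : nat.
Hypothesis d_gt0 : (0 < d)%N.
Hypothesis e_conn : connected_graph e.
Hypothesis deg_le : (bct_max_degree e <= d)%N.

(** One representative for each class at [w] met in [pre]: the set [N] of the algorithm once [pre]
    has been processed. *)
Definition transversal w (pre reps : seq 'I_n) : Prop :=
  [/\ uniq reps, {subset reps <= pre},
      {in reps &, forall u v, joined e w u v -> u = v} &
      {in pre, forall x, exists2 v, v \in reps & joined e w x v}].

Lemma size_transversal w pre reps :
  transversal w pre reps -> w \notin pre -> (size reps <= d)%N.
Proof.
move=> [ureps sub sep _] wpre.
have := @separated_card_le _ _ e_simple _ e_conn deg_le w [set v in reps] d_gt0.
rewrite cardsE (card_uniqP ureps); apply.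
  by rewrite inE; apply: contra wpre; apply: sub.
by move=> u v; rewrite !inE; apply: sep.
Qed.

Lemma ensures_ComponentsSB kappa (V : {set 'I_n}) (delta : R) :
  (1 < #|V|)%N -> (0 < kappa)%N -> 0 < delta <= 1 / 8 ->
  ensures Sigma (ComponentsSB R kappa V)
    (fun Vs => exists w reps,
       [/\ w \in V, {in V, forall v, joined_freq V w < joined_freq V v + 2 * delta},
           transversal w (enum (V :\ w)) reps &
           Vs = [seq w |: branch e V w v | v <- reps]])
    (#|V| * (kappa * 4) + #|V|.-1 * (d * 4))
    (#|V| * (kappa * 11).+2 + #|V|.-1 * (d * 8))
    (#|V|%:R * (2 * expR (- (kappa%:R * delta ^+ 2)))).
Proof.
move=> V1 k0 d8; rewrite -[X in ensures _ _ _ _ _ X]addr0.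
apply: (ensures_bind (lexx 0) (ensures_sCentral V1 k0 d8)) => w [wV wmin].
pose part (pre : seq 'I_n) v := (v, [set x in pre | joined e w x v]).
(* The parts are the traces on [pre] of the classes of the representatives. There are at most [d] of
   these, so each vertex takes at most [d] tests. *)
pose Inv (pre : seq 'I_n) (parts : seq ('I_n * {set 'I_n})) :=
  exists2 reps, transversal w pre reps & parts = [seq part pre v | v <- reps].
have cardVw : #|V|.-1 = #|V :\ w| by rewrite [in LHS](cardsD1 w) wV.
apply: ensures_bind_ret.
pose step (parts : seq ('I_n * {set 'I_n})) u : prog R n _ :=
    let! hit := find_mate R w u [seq vW.1 | vW <- parts] in
    Ret (if hit is Some v then
           [seq (vW.1, if vW.1 == v then u |: vW.2 else vW.2) | vW <- parts]
         else rcons parts (u, [set u])).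
have main := @ensures_foldM _ _ Sigma _ _ step Inv
  (fun=> (d * 4)%N) (fun=> (d * 8)%N) (fun=> 0) [::] (enum (V :\ w)).
apply: ensures_weaken (main _ _ _) => //.
- move=> parts [reps tr ->]; exists w, reps; split => //.
  rewrite -map_comp; apply: eq_map => v /=; congr (_ |: _).
  by apply/setP => x; rewrite !inE mem_enum !inE.
- by rewrite big_enum /= sum_nat_const cardVw.
- by rewrite big_enum /= sum_nat_const cardVw.
- by rewrite big1.
- move=> pre u post parts VE [reps tr ->]; rewrite /step -map_comp.
  have nE : [seq (fst \o part pre) v | v <- reps] = reps by rewrite map_id.
  rewrite {}nE.
  have uV : u \in V :\ w by rewrite -mem_enum VE mem_cat mem_head orbT.
  have wpre : w \notin pre.
    have : w \notin enum (V :\ w) by rewrite mem_enum !inE eqxx.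
    by rewrite VE mem_cat; case/norP.
  have upre : u \notin pre.
    have := enum_uniq (mem (V :\ w)); rewrite VE cat_uniq /= negb_or.
    by case/and3P => _ /andP[].
  have uw : u != w by move: uV; rewrite !inE => /andP[].
  have szle := size_transversal tr wpre.
  case: tr => ureps sub sep cov.
  have wreps : w \notin reps by apply: contra wpre; apply: sub.
  apply: ensures_bind_ret.
  apply: (ensures_weaken _ _ _ (lexx 0) (ensures_find_mate uw wreps));
    rewrite ?leq_mul2r ?szle //.
  case=> [v|] /=.
    move=> [vr uv]; exists reps.
      split=> // x; first by move=> /sub; rewrite mem_rcons inE => ->; rewrite orbT.
      by rewrite mem_rcons inE => /predU1P[->|/cov//]; exists v.
    rewrite -map_comp; apply/eq_in_map => v' v'r /=; congr (_, _).
    apply/setP => x; rewrite [RHS]inE mem_rcons [in RHS]inE.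
    have [->|v'v] := eqVneq v' v; rewrite !inE.
      by case: eqVneq => [->|] //=; rewrite uv.
    case: eqVneq => [->|] //=; rewrite (negPf upre) /=; apply/esym/negbTE.
    apply: contra v'v => uv'; apply/eqP; apply: sep => //.
    by apply: joined_trans uv; rewrite joined_sym.
  move=> none; exists (rcons reps u).
    split.
    - rewrite rcons_uniq ureps andbT; apply/negP => /none.
      by rewrite joined_refl.
    - by move=> x; rewrite !mem_rcons !inE => /predU1P[->|/sub ->]; rewrite ?eqxx ?orbT.
    - move=> x y; rewrite !mem_rcons !inE => /predU1P[->|xr] /predU1P[->|yr] //.
      + by move=> uy; have := none _ yr; rewrite uy.
      + by rewrite joined_sym // => uy; have := none _ xr; rewrite uy.
      + exact: sep.
    - move=> x; rewrite mem_rcons inE => /predU1P[->|/cov[v vr xv]].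
        by exists u; [rewrite mem_rcons mem_head | apply: joined_refl].
      by exists v => //; rewrite mem_rcons inE vr orbT.
  rewrite map_rcons; congr rcons; last first.
    congr (_, _); apply/setP => x; rewrite !inE mem_rcons inE.
    case: eqVneq => [->|] /=; first by rewrite joined_refl.
    (* The new part is [u] alone: an earlier vertex joined to [u] would make its representative a
       hit. *)
    have [xp|//] := boolP (x \in pre); move=> _; apply/esym/negbTE/negP => xu.
    have [v vr xv] := cov _ xp; have := none _ vr.
    by rewrite (joined_trans _ xv) // joined_sym.
  apply/eq_in_map => v vr; congr (_, _); apply/setP => x.
  rewrite !inE mem_rcons inE; case: eqVneq => [->|] //=.
  by rewrite (negPf upre) (negPf (none _ vr)).
- by exists [::].
Qed.

Lemma sum_card_branch V w reps : transversal w (enum (V :\ w)) reps ->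
  (\sum_(v <- reps) #|branch e V w v| = #|V :\ w|)%N.
Proof.
move=> [ureps sub sep cov].
transitivity (\sum_(v <- reps) \sum_(x in V :\ w) joined e w x v)%N.
  apply: eq_bigr => v _; rewrite -sum1_card.
  rewrite [LHS](eq_bigl (fun x => (x \in V :\ w) && joined e w x v)).
    by rewrite big_mkcondr; apply: eq_bigr => x _; case: joined.
  by move=> x; rewrite !inE.
rewrite exchange_big /= -sum1_card; apply: eq_bigr => x.
rewrite -mem_enum => /cov[v vr xv].
rewrite (bigD1_seq v) //= xv big1_seq // => u /andP[uv ur].
apply/eqP; rewrite eqb0; apply: contra uv => xu; apply/eqP; apply: sep => //.
by apply: joined_trans xv; rewrite joined_sym.
Qed.

Lemma sqr_branch_freq_le V w v : (0 < #|V :\ w|)%N ->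
  (#|branch e V w v|%:R / #|V :\ w|%:R) ^+ 2 <= joined_freq V w :> R.
Proof.
move=> V0; rewrite /joined_freq expr_div_n ler_wpM2r ?invr_ge0 ?exprn_ge0 //.
by rewrite -natrX ler_nat; apply: sqr_branch_le.
Qed.

(** The inequality [#|V| <= 2 * (#|V| - 1)] charges the cost of inversion to [#|V| - 1]. *)
Lemma ensures_ReconstructSB_base kappa b0 E (V : {set 'I_n}) j :
  (1 < #|V|)%N -> (#|V| <= d * b0)%N ->
  ensures Sigma (ReconstructSB_rec R kappa d b0 j.+1 E V) (fun=> True)
    (#|V|.-1 * (2 * (d * b0))) (#|V|.-1 * (18 * (d * b0) ^ 2)) 0.
Proof.
move=> V1 base; rewrite [ReconstructSB_rec _ _ _ _ _ _ _]/= ltnNge base /=.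
have arith k D : (1 < k -> k <= D -> k ^ 2 <= k.-1 * (2 * D) /\
    (2 * k ^ 2 + 6 * k ^ 3).+1 <= k.-1 * (18 * D ^ 2))%N.
  clear; case: k => [|[|k]] //= _ kD.
  have kk : (k.+2 * k.+2 <= k.+2 * D)%N by rewrite leq_mul2l kD orbT.
  have kkk : (k.+2 * (k.+2 * k.+2) <= k.+2 * (D * D))%N.
    by rewrite leq_mul2l leq_mul ?orbT.
  by rewrite !expnS !expn0 !muln1; split; nia.
have [cq_le ct_le] := arith _ _ V1 base.
apply: (ensures_weaken (cq := #|V| ^ 2)
  (ct := (2 * #|V| ^ 2 + 6 * #|V| ^ 3).+1) (eta := 0) (Q := fun=> True)) => //.
by apply: ensures_tick; apply: ensures_bind_ret; apply: ensures_conc_edges.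
Qed.

(* The costs are per unit of [#|V| - 1], which is additive over the parts of [V];
   [#|V| - 2] bounds the number of calls of [ComponentsSB]. *)
Lemma ensures_ReconstructSB_rec kappa b0 E V j (eta : R) :
  (0 < kappa)%N -> b0 = max_block_size e ->
  n%:R * (2 * expR (- (kappa%:R / (4 * d%:R) ^+ 2))) <= eta ->
  sep_closed e V -> (1 < #|V|)%N ->
  #|V|.-1%:R * (1 - 1 / (8 * d%:R)) ^+ j < 1 :> R ->
  ensures Sigma (ReconstructSB_rec R kappa d b0 j E V) (fun=> True)
    (#|V|.-1 * ((kappa * 8 + d * 4) * j + 2 * (d * b0)))
    (#|V|.-1 * ((kappa * 22 + d * 8 + 5) * j + 18 * (d * b0) ^ 2))
    ((#|V| - 2)%:R * eta).
Proof.
move=> k0 b0E eta_ge.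
have eta0 : 0 <= eta by apply: le_trans eta_ge; rewrite !mulr_ge0 ?expR_ge0.
set rho := 1 - _; set Aq := (kappa * 8 + _)%N; set At := (_ + 5)%N.
elim: j E V => [|j IH] E V cV V1 small.
  by move: small; rewrite expr0 mulr1 ltrn1; case: #|V| V1 => [|[|]].
have err0 : 0 <= (#|V| - 2)%:R * eta by rewrite mulr_ge0.
have [large|] := ltnP (d * b0) #|V|; last first.
  move=> base.
  by apply: (ensures_weaken _ _ _ err0 (ensures_ReconstructSB_base kappa E j V1 base));
    rewrite // leq_mul2l leq_addl orbT.
rewrite [ReconstructSB_rec _ _ _ _ _ _ _]/= large.
have [d1 [v0 v0V central]] : (1 < d)%N /\ exists2 v, v \in V &
    (4 * d * joined_pairs e V v <= (4 * d - 3) * #|V :\ v| ^ 2)%N.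
  by apply: central_vertex => //; rewrite -b0E.
have dR : 0 < d%:R :> R by rewrite ltr0n.
have d2 : 2 <= d%:R :> R by rewrite ler_nat.
have delta8 : 0 < (1 / (4 * d%:R) : R) <= 1 / 8.
  rewrite divr_gt0 ?mulr_gt0 //= ler_pdivrMr ?mulr_gt0 //; lra.
have cardV w : w \in V -> #|V :\ w| = #|V|.-1.
  by move=> wV; rewrite [in RHS](cardsD1 w) wV.
have M0 : (0 < #|V|.-1)%N by rewrite -ltnS prednK // ltnW.
have MR : 0 < #|V|.-1%:R :> R by rewrite ltr0n.
have central_freq : joined_freq V v0 <= 1 - 3 / (4 * d%:R).
  rewrite /joined_freq cardV // ler_pdivrMr ?exprn_gt0 //.
  have d40 : 0 < 4 * d%:R :> R by rewrite mulr_gt0.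
  rewrite -(ler_pM2l d40) mulrA.
  have -> : 4 * d%:R * (1 - 3 / (4 * d%:R)) = 4 * d%:R - 3 :> R.
    by field; rewrite gt_eqF.
  move: central; rewrite cardV // -(ler_nat R) !natrM natrB ?natrM ?natrX //.
  by rewrite (leq_trans _ (leq_mul (leqnn 4) d_gt0)).
(* With two vertices the only pair at [v0] would be joined. Three vertices keep the truncated
   [#|V|.-1 - 2] below exact. *)
have M2 : (1 < #|V|.-1)%N.
  rewrite ltn_neqAle M0 andbT; apply/eqP => M1.
  have /card_gt0P[u uV] : (0 < #|V :\ v0|)%N by rewrite cardV.
  have u_br : (0 < #|branch e V v0 u|)%N.
    by apply/card_gt0P; exists u; move: uV; rewrite !inE joined_refl andbT.
  move: central u_br (sqr_branch_le e_simple V v0 u) d_gt0; rewrite cardV // -M1.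
  by move: (joined_pairs _ _ _) #|branch _ _ _ _| => p k; clear; nia.
(* One call of [ComponentsSB], then the parts at depth [j]. The inequality [#|V| <= 2 * (#|V| - 1)]
   doubles the coefficients 4 and 11 of [kappa]; the 5 is twice 2 plus the size test. *)
apply: (ensures_weaken
  (cq := (#|V| * (kappa * 4) + #|V|.-1 * (d * 4)) + #|V|.-1 * (Aq * j + 2 * (d * b0)))
  (ct := ((#|V| * (kappa * 11).+2 + #|V|.-1 * (d * 8)) +
     #|V|.-1 * (At * j + 18 * (d * b0) ^ 2)).+1)
  (eta := eta + (#|V|.-1 - 2)%:R * eta)  (Q := fun=> True)) => //.
- have arith m k X : (1 < m -> m * (k * 4) + m.-1 * (d * 4) + m.-1 * X <=
      m.-1 * ((k * 8 + d * 4) + X))%N by clear; case: m => [|[|m]] //= _; nia.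
  by rewrite [in leqRHS]mulnS -[in leqRHS]addnA; apply: arith.
- have arith m k X : (1 < m -> (m * (k * 11).+2 + m.-1 * (d * 8) + m.-1 * X).+1 <=
      m.-1 * ((k * 22 + d * 8 + 5) + X))%N by clear; case: m => [|[|m]] //= _; nia.
  by rewrite [in leqRHS]mulnS -[in leqRHS]addnA; apply: arith.
- rewrite -[X in X + _]mul1r -mulrDl ler_wpM2r // nat1r ler_nat.
  by case: #|V| M2 => [|[|[|m]]] // _; rewrite /= !subSS !subn0.
apply: ensures_tick.
apply: (ensures_bind _ (ensures_weaken _ (leqnn _) (leqnn _) _
  (ensures_ComponentsSB V1 k0 delta8))).
- by rewrite mulr_ge0.
- move=> a; exact: id.
- apply: le_trans eta_ge; apply: ler_pM => //.
  + by rewrite mulr_ge0 ?expR_ge0.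
  + by rewrite ler_nat -[X in (_ <= X)%N]card_ord max_card.
  + rewrite div1r exprVn lexx //.
move=> _ [w [reps [wV wmin tr ->]]].
have wfreq : joined_freq V w <= 1 - 1 / (4 * d%:R).
  have := wmin _ v0V; lra.
have i8 : 0 < (1 / (8 * d%:R) : R) <= 1 / 16.
  by rewrite divr_gt0 ?mulr_gt0 //= ler_pdivrMr ?mulr_gt0 //; lra.
have rho0 : 0 <= rho by rewrite /rho; lra.
(* The squared fraction of a class is at most [1 - 1 / (4 * d)], hence at most [rho ^+ 2]. *)
have part_le v : #|branch e V w v|%:R <= rho * #|V|.-1%:R.
  rewrite -ler_pdivrMr //.
  rewrite -(ler_pXn2r (n := 2)) ?nnegrE ?divr_ge0 //.
  have := @sqr_branch_freq_le V w v; rewrite cardV // => /(_ M0) le.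
  apply: (le_trans le); apply: (le_trans wfreq).
  have -> : 1 / (4 * d%:R) = 2 * (1 / (8 * d%:R)) :> R by field; rewrite gt_eqF.
  rewrite /rho; have := sqr_ge0 (1 / (8 * d%:R) : R).
  by move: (1 / (8 * d%:R)) => i; rewrite sqrrB; lra.
have sumE := sum_card_branch tr; rewrite cardV // in sumE.
have [ureps sub _ _] := tr.
(* A single part would be all of [V], exceeding the fraction [rho]. *)
have reps2 : (1 < size reps)%N.
  case: reps sumE {tr ureps sub} => [|v [|//]]; rewrite ?big_nil ?big_seq1 => sumE.
    by rewrite -sumE in M0.
  have := part_le v; rewrite sumE -[leLHS]mul1r ler_pM2r // /rho; lra.
have br_gt0 v : v \in reps -> (0 < #|branch e V w v|)%N.
  move=> /sub; rewrite mem_enum => vV; apply/card_gt0P; exists v.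
  by rewrite inE vV joined_refl.
have cardp v : #|w |: branch e V w v| = #|branch e V w v|.+1.
  by rewrite cardsU1 !inE eqxx.
have partP V' : V' \in [seq w |: branch e V w v | v <- reps] ->
    [/\ sep_closed e V', (1 < #|V'|)%N & #|V'|.-1%:R * rho ^+ j < 1].
  move=> /mapP[v vr ->]; rewrite cardp ltnS br_gt0 //=; split => //.
    have := sub _ vr; rewrite mem_enum !inE => /andP[vw vV].
    exact: sep_closed_branch.
  apply: le_lt_trans small; rewrite exprS mulrA ler_wpM2r ?exprn_ge0 //.
  by rewrite mulrC part_le.
set Vs := [seq _ | v <- reps] in partP *.
have main := @ensures_foldM _ _ Sigma _ _ (ReconstructSB_rec R kappa d b0 j) (fun _ _ => True)
  (fun V' => #|V'|.-1 * (Aq * j + 2 * (d * b0)))%N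
  (fun V' => #|V'|.-1 * (At * j + 18 * (d * b0) ^ 2))%N
  (fun V' => (#|V'| - 2)%:R * eta) E Vs.
apply: ensures_weaken (main _ _ _) => //.
- by rewrite -big_distrl /= big_map; under eq_bigr => v _ do rewrite cardp /=; rewrite sumE.
- by rewrite -big_distrl /= big_map; under eq_bigr => v _ do rewrite cardp /=; rewrite sumE.
(* Each part counts one less than its class, so two or more parts sum to at most [#|V| - 3]. *)
- rewrite -mulr_suml -natr_sum ler_wpM2r // ler_nat big_map.
  rewrite leq_subRL // -sumE addnC.
  apply: leq_trans (leq_add (leqnn _) reps2) _.
  rewrite -sum1_size -big_split /= big_seq [leqRHS]big_seq; apply: leq_sum => v vr.
  by rewrite cardp subSS subnK // br_gt0.
- by move=> V'; rewrite mulr_ge0.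
- move=> pre V' post E' VsE _; have [] := partP V'; last exact: IH.
  by rewrite VsE mem_cat mem_head orbT.
Qed.

End BoundedDegree.

End Algorithm.

(** * Constants and conclusion *)

Section Constants.
Variable R : realType.
Implicit Types (D N B l L K J : R).

Lemma ln2_ge_half : 1 / 2 <= ln 2 :> R.
Proof.
have := @le_ln1Dx R (- (1 / 2)); have -> : 1 - 1 / 2 = 2^-1 :> R by field.
rewrite lnV ?posrE // => /(_ _); have -> : (- 1 < - (1 / 2) :> R) by lra.
by move=> /(_ isT); rewrite lerN2.
Qed.

(** [K], [J] and [g] stand for [kappa], the depth and the base cost. As
    [D <= D ^+ 2 <= 2 * (D ^+ 2 * L)], one level has constant at most
    [98 * 22 + 8 * 2 + 5 * 2 <= 100 * 22], and [J] brings the factor 10. *)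
Lemma cost_bound (a c f g : R) D B l L K J :
  1 <= D -> 0 <= B -> 0 <= l -> 1 / 2 <= L -> 0 <= K <= 98 * D ^+ 2 * L ->
  0 <= J <= 10 * D * l -> 0 <= a <= 22 -> 0 <= c <= 8 -> 0 <= f <= 5 ->
  g <= 36 * (D ^+ 3 * l * B) ->
  (K * a + D * c + f) * J + g <= 100 * 220 * (D ^+ 3 * l * (L + B)).
Proof.
move=> D1 B0 l0 L2 /andP[K0 Kle] /andP[J0 Jle] /andP[a0 ale] /andP[c0 cle] /andP[f0 fle] gle.
have D0 : 0 <= D := le_trans ler01 D1.
have L0 : 0 <= L by clear - L2; lra.
have D2L : D ^+ 2 <= 2 * (D ^+ 2 * L).
  rewrite mulrCA -[leLHS]mulr1 ler_wpM2l ?exprn_ge0 //; clear - L2; lra.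
have DD : D <= D ^+ 2 by rewrite expr2 ler_peMr.
have h1 : K * a <= 98 * 22 * (D ^+ 2 * L).
  have -> : 98 * 22 * (D ^+ 2 * L) = 98 * D ^+ 2 * L * 22 by ring.
  exact: ler_pM.
have h2 : D * c <= D * 8 by apply: ler_pM.
have h3 : K * a + D * c + f <= 100 * 22 * (D ^+ 2 * L).
  move: (D ^+ 2) (D ^+ 2 * L) (K * a) (D * c) D2L DD h1 h2 D1 fle => x y z w.
  by clear; lra.
have h4 : (K * a + D * c + f) * J <= 100 * 22 * (D ^+ 2 * L) * (10 * D * l).
  by apply: ler_pM => //; rewrite !addr_ge0 ?mulr_ge0.
apply: (le_trans (lerD h4 gle)).
have -> : 100 * 22 * (D ^+ 2 * L) * (10 * D * l) = 100 * 220 * (D ^+ 3 * l * L) by ring.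
rewrite (mulrDr (D ^+ 3 * l)) (mulrDr (100 * 220)).
have Dl0 : 0 <= D ^+ 3 * l by rewrite mulr_ge0 ?exprn_ge0.
rewrite lerD2l ler_wpM2r ?mulr_ge0 //; clear; lra.
Qed.

End Constants.

Lemma ceil_nat_itv (R : realType) (x : R) : 0 <= x ->
  x <= `|Num.ceil x|%N%:R <= x + 1.
Proof.
move=> x0; have c0 : 0 <= Num.ceil x by rewrite ceil_ge0 (lt_le_trans _ x0) // ltrN10.
have -> : `|Num.ceil x|%N%:R = (Num.ceil x)%:~R :> R.
  by rewrite -[in RHS](gez0_abs c0) pmulrn.
have /andP[lt le] := ceil_itv x; rewrite le /=.
by move: lt; rewrite intrB; lra.
Qed.

(** * The size of [kappa], the union bound and the recursion depth *)

Section Asymptotics.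
Variables (R : realType) (n d : nat) (eps : R).
Hypotheses (n_gt1 : (1 < n)%N) (d_gt0 : (0 < d)%N) (eps_gt0 : 0 < eps) (eps_lt1 : eps < 1).

Let n0 : 0 < n%:R :> R. Proof. by rewrite ltr0n ltnW. Qed.
Let d0 : 0 < d%:R :> R. Proof. by rewrite ltr0n. Qed.
Let d1 : 1 <= d%:R :> R. Proof. by rewrite ler1n. Qed.
Let l : R := ln n%:R.
Let L : R := ln (n%:R / eps).
Let L' : R := ln (2 * d%:R * n%:R / eps).

Lemma ln_ge_half : 1 / 2 <= l.
Proof. by apply: (le_trans (ln2_ge_half R)); rewrite ler_ln ?posrE // ler_nat. Qed.

Let ratio_gt0 : 0 < n%:R / eps. Proof. by rewrite divr_gt0. Qed.

Lemma ratio_ge : n%:R <= n%:R / eps.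
Proof. by rewrite ler_pdivlMr // ler_piMr // ltW. Qed.

Lemma ln_ratio_ge_half : 1 / 2 <= L.
Proof. by apply: (le_trans ln_ge_half); rewrite ler_ln ?posrE // ratio_ge. Qed.

Let arg_gt0 : 0 < 2 * d%:R * n%:R / eps. Proof. by rewrite divr_gt0 ?mulr_gt0. Qed.

Lemma ln_arg_ge_half : 1 / 2 <= L'.
Proof.
apply: (le_trans ln_ratio_ge_half); rewrite ler_ln ?posrE // -[leRHS]mulrA.
by rewrite ler_peMl ?(ltW ratio_gt0) // mulr_ege1 // ler1n.
Qed.

(** Both 2 and [d] are at most [n / eps], so the argument of [L'] is at most the cube of
    [n / eps]. *)
Lemma ln_arg_le : (d <= n)%N -> L' <= 3 * L.
Proof.
move=> dn; rewrite /L' [leRHS]mulr_natl /L -lnXn // ler_ln ?posrE ?exprn_gt0 //.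
rewrite -[leLHS]mulrA exprSr (ler_wpM2r (ltW ratio_gt0)) // expr2.
apply: ler_pM => //; apply: le_trans ratio_ge; by rewrite ler_nat.
Qed.

Let d2_ge1 : 1 <= d%:R ^+ 2 :> R. Proof. exact: exprn_ege1. Qed.

Lemma kappa_of_itv : 32 * d%:R ^+ 2 * L' <= (kappa_of d n eps)%:R <= 32 * d%:R ^+ 2 * L' + 1.
Proof.
apply: ceil_nat_itv; rewrite !mulr_ge0 ?exprn_ge0 //.
by apply: le_trans ln_arg_ge_half; rewrite divr_ge0.
Qed.

Lemma kappa_of_gt0 : (0 < kappa_of d n eps)%N.
Proof.
have /andP[le _] := kappa_of_itv; rewrite -(ltr0n R); apply: lt_le_trans le.
by rewrite !mulr_gt0 ?exprn_gt0 // (lt_le_trans _ ln_arg_ge_half) // divr_gt0.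
Qed.

Lemma kappa_of_le : (d <= n)%N -> (kappa_of d n eps)%:R <= 98 * d%:R ^+ 2 * L.
Proof.
move=> dn; have /andP[_ le] := kappa_of_itv; apply: (le_trans le).
have h1 : 1 * (1 / 2) <= d%:R ^+ 2 * L.
  by apply: ler_pM ln_ratio_ge_half; rewrite ?divr_ge0.
have h2 : d%:R ^+ 2 * L' <= 3 * (d%:R ^+ 2 * L).
  by rewrite mulrCA ler_wpM2l ?exprn_ge0 // ln_arg_le.
rewrite -[X in X + 1]mulrA -[leRHS]mulrA; move: (d%:R ^+ 2 * L') (d%:R ^+ 2 * L) h1 h2 => x y h1 h2.
(* The 1 from rounding up is at most [2 * y]. *)
have -> : 98 * y = 32 * (3 * y) + y * 2 by ring.
by apply: lerD; rewrite ?ler_wpM2l // -ler_pdivrMr // -[leLHS]mul1r.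
Qed.

(** The 32 makes the exponent at least [2 * L'], so each tail is at most [y ^+ 2]: one factor [y]
    pays for the [k] calls, the other for the estimates in each. *)
Lemma union_bound k : (k <= n)%N ->
  k%:R * (n%:R * (2 * expR (- ((kappa_of d n eps)%:R / (4 * d%:R) ^+ 2)))) <= eps.
Proof.
move=> kn; set y := eps / (2 * d%:R * n%:R).
have expL : expR (- L') = y by rewrite expRN lnK ?posrE // invf_div.
have tail : expR (- ((kappa_of d n eps)%:R / (4 * d%:R) ^+ 2)) <= y ^+ 2.
  rewrite -expL -expRM_natl ler_expR mulrN lerN2 ler_pdivlMr ?exprn_gt0 ?mulr_gt0 //.
  have /andP[+ _] := kappa_of_itv; apply: le_trans.
  rewrite exprMn; move: (d%:R ^+ 2) => x; rewrite le_eqVlt; apply/orP; left.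
  by apply/eqP; ring.
have y0 : 0 <= y by rewrite divr_ge0 ?mulr_ge0 // ltW.
apply: (@le_trans _ _ (n%:R * (n%:R * (2 * y ^+ 2)))).
  by apply: ler_pM; rewrite ?mulr_ge0 ?expR_ge0 ?ler_nat // !ler_wpM2l.
have -> : n%:R * (n%:R * (2 * y ^+ 2)) = eps * (eps / (2 * d%:R ^+ 2)).
  by rewrite /y; field; rewrite !gt_eqF.
rewrite ler_piMr ?(ltW eps_gt0) // ler_pdivrMr ?mulr_gt0 ?exprn_gt0 // mul1r.
by rewrite (le_trans (ltW eps_lt1)) // mulr_ege1 // ler1n.
Qed.

(** By [1 - x <= expR (- x)], a depth of [8 * d * ln n] rounded up brings the power down to [1 / n];
    rounding adds 1, at most [2 * d * l]. *)
Lemma recursion_depth : exists J : nat,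
  n.-1%:R * (1 - 1 / (8 * d%:R)) ^+ J < 1 :> R /\ J%:R <= 10 * d%:R * l.
Proof.
have l0 : 0 <= l by apply: le_trans ln_ge_half; rewrite divr_ge0.
have [|lo hi] := andP (@ceil_nat_itv _ (8 * d%:R * l) _); first by rewrite !mulr_ge0.
exists `|Num.ceil (8 * d%:R * l)|%N; split; last first.
  have dl : 1 * (1 / 2) <= d%:R * l by apply: ler_pM ln_ge_half; rewrite ?divr_ge0.
  apply: (le_trans hi); rewrite -!mulrA.
  have -> : 10 * (d%:R * l) = 8 * (d%:R * l) + d%:R * l * 2 by ring.
  by rewrite lerD2l -ler_pdivrMr // -[leLHS]mul1r.
move: `|_|%N lo => J lo {hi}.
have rhoJ : (1 - 1 / (8 * d%:R)) ^+ J <= expR (- l).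
  apply: (@le_trans _ _ (expR (- (1 / (8 * d%:R))) ^+ J)).
    apply: lerXn2r; rewrite ?nnegrE ?expR_ge0 ?expR_ge1Dx //.
    by rewrite subr_ge0 ler_pdivrMr ?mulr_gt0 // mul1r mulr_ege1 // ler1n.
  rewrite -expRM_natl ler_expR mulrN lerN2 mul1r ler_pdivlMr ?mulr_gt0 //.
  by rewrite mulrC.
have n1 : (0 < n.-1)%N by rewrite -ltnS prednK // ltnW.
apply: (le_lt_trans (ler_wpM2l _ rhoJ)) => //.
by rewrite expRN lnK ?posrE // ltr_pdivrMr // mul1r ltr_nat prednK // ltnW.
Qed.

Lemma total_cost_le (x y z c w K J : R) (k : nat) :
  0 <= K <= 98 * d%:R ^+ 2 * L -> 0 <= J <= 10 * d%:R * l ->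
  0 <= x <= 22 -> 0 <= y <= 8 -> 0 <= z <= 5 -> 0 <= w ->
  c <= 36 * (d%:R ^+ 3 * l * w) ->
  k%:R <= n.-1%:R * ((K * x + d%:R * y + z) * J + c) ->
  k%:R <= 100 * 220 * (d%:R ^+ 3 * n%:R * l * (L + w)).
Proof.
move=> hK hJ hx hy hz w0 hc /le_trans; apply.
have l0 : 0 <= l by apply: le_trans ln_ge_half; rewrite divr_ge0.
have L0 : 0 <= L by apply: le_trans ln_ratio_ge_half; rewrite divr_ge0.
have le := cost_bound d1 w0 l0 ln_ratio_ge_half hK hJ hx hy hz hc.
have -> : 100 * 220 * (d%:R ^+ 3 * n%:R * l * (L + w)) =
    n%:R * (100 * 220 * (d%:R ^+ 3 * l * (L + w))).
  move: (100 * 220) (d%:R ^+ 3) (L + w) => u v k'.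
  by rewrite [v * _]mulrC -!mulrA [RHS]mulrCA.
apply: (le_trans (ler_wpM2l _ le)); first by rewrite ler0n.
by rewrite ler_wpM2r ?ler_nat ?leq_pred // !mulr_ge0 ?exprn_ge0 ?addr_ge0.
Qed.

(** Base costs carry no logarithm; [ln n >= 1 / 2] inserts one at the price of a factor 2. *)
Let base_le (x y : R) : 0 <= x -> 1 <= y -> 18 * x <= 36 * (x * (d%:R ^+ 2 * y * l)).
Proof.
move=> x0 y1; have dyl : 1 / 2 <= d%:R ^+ 2 * y * l.
  apply: (le_trans ln_ge_half); rewrite ler_peMl ?mulr_ege1 //.
  by apply: le_trans ln_ge_half; rewrite divr_ge0.
have -> : 18 * x = 36 * (x * (1 / 2)) by field.
by rewrite ler_wpM2l // ler_wpM2l.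
Qed.

Lemma base_queries_le (b : nat) : (0 < b)%N ->
  2 * (d%:R * b%:R) <= 36 * (d%:R ^+ 3 * l * b%:R ^+ 2).
Proof.
move=> b0; have -> : 36 * (d%:R ^+ 3 * l * b%:R ^+ 2) =
    36 * (d%:R * b%:R * (d%:R ^+ 2 * b%:R * l)) by ring.
apply: le_trans (base_le _ _); rewrite ?mulr_ge0 ?ler1n //.
by rewrite ler_wpM2r ?mulr_ge0 ?ler_nat.
Qed.

Lemma base_time_le (b : nat) : (0 < b)%N ->
  18 * (d%:R * b%:R) ^+ 2 <= 36 * (d%:R ^+ 3 * l * (d%:R * b%:R ^+ 3)).
Proof.
move=> b0; have -> : 36 * (d%:R ^+ 3 * l * (d%:R * b%:R ^+ 3)) =
    36 * ((d%:R * b%:R) ^+ 2 * (d%:R ^+ 2 * b%:R * l)) by ring.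
by apply: base_le; rewrite ?exprn_ge0 ?mulr_ge0 ?ler1n.
Qed.

End Asymptotics.

Lemma max_block_size_gt0 (n : nat) (e : rel 'I_n) :
  simple_graph e -> connected_graph e -> (1 < n)%N -> (0 < max_block_size e)%N.
Proof.
move=> es ec n1; pose v0 : 'I_n := Ordinal (ltnW n1); pose v1 : 'I_n := Ordinal n1.
have v10 : v1 != v0 by [].
have [y vy _] := neighbour_joined es ec v10.
have [B blB /andP[vB _]] := block_edge es vy.
apply: leq_trans (@leq_bigmax_cond _ (block e) (fun B : {set 'I_n} => #|B|) B blB).
by apply/card_gt0P; exists v0.
Qed.

(** A single truncation bounds the supremum from below, the probabilities being bounded by 1. *)
Lemma Pr_rec_ge (R : realType) n (Sigma : 'M[R]_n) A (P : nat -> nat -> bool)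
    (p : nat -> prog R n A) k Q cq ct eta :
  ensures Sigma (p k) Q cq ct eta ->
  (forall q t, (q <= cq)%N -> (t <= ct)%N -> P q t) ->
  1 - eta <= Pr_rec Sigma P p.
Proof.
move=> H HP; apply: (@le_trans _ _ (Pr Sigma P (p k))).
  apply: (le_trans (H 0%N 0%N)); apply: le_expect => a q t; apply: ler_natb.
  by move=> /and3P[_]; apply: HP.
apply: ub_le_sup; last by exists k.
exists 1 => _ [j _ <-].
apply: (@le_trans _ _ (expect Sigma (fun _ _ _ => 1) (p j) 0 0)).
  by apply: le_expect => a q t; rewrite lern1 leq_b1.
exact: expect_cst_le.
Qed.

Theorem theorem14 (R : realType) :
  exists C : R, 0 < C /\
  forall (n d : nat) (e : rel 'I_n) (Sigma : 'M[R]_n) (eps : R),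
    (2 <= n)%N -> (1 <= d)%N ->
    simple_graph e -> connected_graph e ->
    (bct_max_degree e <= d)%N ->
    0 < eps < 1 ->
    in_model e Sigma -> generic e Sigma ->
    let b := max_block_size e in
    1 - eps <=
      Pr_rec Sigma
        (fun queries time : nat =>
           (queries%:R <= C * (d%:R ^+ 3 * n%:R * ln n%:R
                                * (ln (n%:R / eps) + b%:R ^+ 2))) &&
           (time%:R <= C * (d%:R ^+ 3 * n%:R * ln n%:R
                             * (ln (n%:R / eps) + d%:R * b%:R ^+ 3))))
        (ReconstructSB R n (kappa_of d n eps) d b).
Proof.
exists (100 * 220); split=> [|n d e Sigma eps n2 d1 es ec deg]; first by rewrite mulr_gt0.
move=> /andP[eps0 eps1] [pd _] gen.
cbv zeta; set b := max_block_size e.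
have b1 : (0 < b)%N by apply: max_block_size_gt0.
have base_q := base_queries_le R n2 d1 b1; have base_t := base_time_le R n2 d1 b1.
have w_q : 0 <= b%:R ^+ 2 :> R by rewrite exprn_ge0.
have w_t : 0 <= d%:R * b%:R ^+ 3 :> R by rewrite mulr_ge0 ?exprn_ge0.
have l0 := le_trans (divr_ge0 ler01 (ler0n _ 2)) (ln_ge_half R n2).
have L0 := le_trans (divr_ge0 ler01 (ler0n _ 2)) (ln_ratio_ge_half n2 eps0 eps1).
have cost := total_cost_le n2 d1 eps0 eps1.
have cV : sep_closed e [set: 'I_n] by move=> x y z; rewrite !inE.
have V1 : (1 < #|[set: 'I_n]|)%N by rewrite cardsT card_ord.
have i k m : (k <= m)%N -> 0 <= (k%:R : R) <= m%:R by rewrite ler0n ler_nat.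
(* If [n <= d * b], the first call is a base case: depth 1 suffices, and [kappa] and the depth enter
   the cost as 0. Otherwise [d <= d * b < n], as the bound on [kappa] requires. *)
have [small|large] := leqP n (d * b).
  have K0 : 0 <= (0 : R) <= 98 * d%:R ^+ 2 * ln (n%:R / eps).
    by rewrite lexx !mulr_ge0 ?exprn_ge0.
  have J0 : 0 <= (0 : R) <= 10 * d%:R * ln n%:R by rewrite lexx !mulr_ge0.
  apply: (@le_trans _ _ (1 - 0)); first by rewrite lerD2l lerN2 ltW.
  have small' : (#|[set: 'I_n]| <= d * b)%N by rewrite cardsT card_ord.
  have main : ensures Sigma (ReconstructSB R n (kappa_of d n eps) d b 1) _ _ _ _ :=
    ensures_ReconstructSB_base Sigma _ set0 0 V1 small'.
  apply: (Pr_rec_ge main); rewrite cardsT card_ord => q t qle tle; apply/andP; split.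
    apply: (cost _ _ _ _ _ _ _ _ K0 J0 (i 0 22 isT) (i 0 8 isT) (i 0 5 isT) w_q base_q).
    by rewrite mulr0 add0r; move: qle; rewrite -(ler_nat R) !natrM.
  apply: (cost _ _ _ _ _ _ _ _ K0 J0 (i 0 22 isT) (i 0 8 isT) (i 0 5 isT) w_t base_t).
  by rewrite mulr0 add0r; move: tle; rewrite -(ler_nat R) !(natrM, natrX).
have dn : (d <= n)%N by rewrite (leq_trans _ (ltnW large)) // leq_pmulr.
have [J [depth Jle]] := @recursion_depth R n d n2 d1.
have K0 : 0 <= ((kappa_of d n eps)%:R : R) <= 98 * d%:R ^+ 2 * ln (n%:R / eps).
  by rewrite ler0n kappa_of_le.
have J0 : 0 <= (J%:R : R) <= 10 * d%:R * ln n%:R by rewrite ler0n.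
rewrite -[n in n.-1]card_ord -cardsT in depth.
have main : ensures Sigma (ReconstructSB R n (kappa_of d n eps) d b J) _ _ _ _ :=
  ensures_ReconstructSB_rec es pd gen d1 ec deg set0 (kappa_of_gt0 n2 d1 eps0 eps1) erefl
  (lexx _) cV V1 depth.
have err := union_bound n2 d1 eps0 eps1 (leq_subr 2 n).
apply: (le_trans _ (Pr_rec_ge main _)).
  by rewrite lerD2l lerN2 cardsT card_ord.
rewrite cardsT card_ord -/b => q t qle tle; apply/andP; split.
  apply: (cost _ _ _ _ _ _ _ _ K0 J0 (i 8 22 isT) (i 4 8 isT) (i 0 5 isT) w_q base_q).
  by move: qle; rewrite -(ler_nat R) addr0 !(natrM, natrD).
apply: (cost _ _ _ _ _ _ _ _ K0 J0 (i 22 22 isT) (i 8 8 isT) (i 5 5 isT) w_t base_t).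
by move: tle; rewrite -(ler_nat R) !(natrM, natrD, natrX).
Qed.
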